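(* In every $2$-colouring of the edges of $K_{\mathbb{N}}$, there exists a monochromatic (infinite) path $P$ with $\bar d(P)\ge \frac{12+\sqrt{8}}{17}$.
   Context: $\mathbb{N}$ denotes the set of positive integers with the standard ordering, and $K_{\mathbb{N}}$ is the complete (simple, undirected) graph with vertex set $\mathbb{N}$. A $2$-colouring of the edges is an arbitrary map from the edge set to a set of two colours (red and blue). An infinite path $P$ is a (one-way infinite) graph with vertex set $V(P)=\{v_i : i\in\mathbb{N}\}$ (the $v_i$ being distinct) and edge set $E(P)=\{v_iv_{i+1} : i\in\mathbb{N}\}$; the paths considered here are infinite paths that are subgraphs of $K_{\mathbb{N}}$. The vertices need not appear along the path in increasing order. A path is monochromatic if all its edges have the same colour. For a graph $G$ with $V(G)\subseteq\mathbb{N}$, the upper density of $G$ is $$\bar d(G)=\limsup_{t\to\infty}\frac{|V(G)\cap\{1,2,\ldots,t\}|}{t}.$$ *)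

(* Defs.v *)
From HB Require Import structures.
From mathcomp Require Import all_boot all_order all_algebra finmap.
From mathcomp Require Import all_classical all_reals.
From mathcomp Require Import topology normedtype sequences.

Set Implicit Arguments.
Unset Strict Implicit.
Unset Printing Implicit Defensive.

Import Order.TTheory GRing.Theory Num.Theory.

Local Open Scope classical_set_scope.

(* An edge is the two-element set of its endpoints. *)
Record graph (T : Type) := Graph {
  vertices : set T;
  edges : set (set T);
  edgesP : forall e, edges e ->
    exists x y, [/\ vertices x, vertices y, x <> y & e = [set x; y]]
}.

Definition subgraph (T : Type) (H G : graph T) : Prop :=
  vertices H `<=` vertices G /\ edges H `<=` edges G.

Definition complete_graph (T : Type) (V : set T) : graph T :=
  @Graph T V
    [set e | exists x y, [/\ V x, V y, x <> y & e = [set x; y]]]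
    (fun _ h => h).

Definition KN : graph nat := complete_graph [set n | (0 < n)%N].

Variant colour := Red | Blue.

(* v 0, v 1, ... play the role of v_1, v_2, ... *)
Definition infinite_path (T : Type) (P : graph T) : Prop :=
  exists v : nat -> T,
    [/\ injective v,
        vertices P = [set v i | i in [set: nat]] &
        edges P = [set [set v i; v i.+1] | i in [set: nat]]].

(* The colouring is only defined on the edges of G, so e ranges over the
   subtype of these; for a subgraph P of G this covers all edges of P. *)
Definition monochromatic (T : Type) (G : graph T) (c : edges G -> colour)
    (P : graph T) : Prop :=
  exists k : colour, forall e : edges G, edges P (val e) -> c e = k.

(* The term at t = 0 is 0 / 0 = 0 and does not affect the limit superior. The
   sequence takes its values in [0, 1], so its real-valued limn_sup is the
   genuine one. *)
Definition upper_density (R : realType) (G : graph nat) : R :=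
  limn_sup (fun t : nat =>
    (#|` fset_set (vertices G `&` [set n | (1 <= n <= t)%N]) |%:R / t%:R)%R).

(* Main.v *)
Require Import Defs.
From mathcomp Require Import finmap all_classical all_reals.
From mathcomp Require Import topology normedtype sequences.
From mathcomp Require Import all_boot all_order all_algebra.
From mathcomp Require Import zify ring lra.

(** A nonprincipal ultrafilter colours each vertex u with the colour that almost
    all edges at u have. Two vertices of the same colour k then have arbitrarily
    large common neighbours that are joined to both by edges of colour k
    ([common_neighbours]). Hence disjoint paths of colour k whose ends have vertex
    colour k can be strung together, and it suffices to find, for one colour k
    and outside any finite set, finite forests of such paths that cover almost
    (12 + sqrt 8) / 17 of arbitrarily long intervals [1, t]
    ([infinite_monochromatic_path], [dense_colour]).

    A forest of colour k may contain every vertex of colour k as a trivial path,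
    so what matters is how many vertices of the other colour can be inserted
    between vertices of colour k. For matchings instead of paths the theorem of
    Koenig would answer this. Its counterpart for forests is [forest_or_cover]:
    if about m vertices of X cannot be inserted between vertices of Z, then some
    subset Y of X has, up to a bounded number of edges at each vertex, a
    neighbourhood N in Z with |N| at most about |Y| - m. The proof gives each
    vertex of X a large constant number D of neighbours in Z, so that the loads
    on Z are as even as possible ([load_balancing]). Where the loads exceed D
    the obstruction appears ([assignment_or_cover]). Otherwise Hall's theorem
    turns the assignment into two matchings; distributing the vertices over many
    levels beforehand lets the two matchings together form paths
    ([levelled_matchings], [join_matchings]).

    Let c be slightly larger than 1 - (12 + sqrt 8) / 17 and suppose that on no
    long interval [1, t] a forest of either colour misses at most c t vertices. Each
    t then yields obstructions in both colours, of sizes y t and y' t, to be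
    found disjointly in [1, t]. The obstruction for red at t and the one for
    blue at s leave almost no colour for the edges between them, unless one is
    absorbed by the small neighbourhood of the other. This forces
    y t + c s <= y' s or y' s + c t <= y t for all s and t ([dense_forest]).
    Such sequences must overtake one another over and over, gaining c t each
    time, and y t + y' t <= t does not leave enough room when
    17 c^2 - 10 c + 1 < 0 ([no_long_interleaving]). *)

Set Implicit Arguments.
Unset Strict Implicit.
Unset Printing Implicit Defensive.

Import Order.TTheory GRing.Theory Num.Theory.

(** * Matchings *)

(** Induction on A, in the manner of Halmos and Vaughan: a nonempty proper
    subset with no slack is matched on its own and the rest is matched outside
    its neighbourhood; without such a subset any one pair can be removed. *)
Lemma hall (T : finType) (N : T -> {set T}) (A : {set T}) :
  (forall B : {set T}, B \subset A -> #|B| <= #|\bigcup_(x in B) N x|) ->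
  exists2 f : T -> T, {in A &, injective f} & {in A, forall x, f x \in N x}.
Proof.
have [n] := ubnP #|A|; elim: n => // n IHn in N A *; rewrite ltnS => leAn hallA.
have [->|[x0 x0A]] := set_0Vmem A.
  by exists id => x; rewrite inE.
case: (boolP [exists B : {set T}, [&& B \proper A, B != set0 &
    #|\bigcup_(x in B) N x| <= #|B|]]) => [|noB].
- case/existsP=> B /and3P[ltBA B0 tightB].
  have sBA := proper_sub ltBA.
  set NB := \bigcup_(x in B) N x.
  have cardNB : #|NB| = #|B| by apply/eqP; rewrite eqn_leq tightB hallA.
  have [|C sCB|f1 inj1 mem1] := IHn N B.
  + by apply: leq_trans leAn; apply: proper_card.
  + by apply: hallA; apply: subset_trans sBA.
  have [|C sCD|f2 inj2 mem2] := IHn (fun x => N x :\: NB) (A :\: B).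
  + apply: leq_trans leAn; rewrite cardsD (setIidPr sBA) ltn_subrL.
    by rewrite !card_gt0 B0; apply/set0Pn; exists x0.
  + have dCB : [disjoint C & B].
      by move: sCD; rewrite subsetD => /andP[].
    have sCA : C \subset A by move: sCD; rewrite subsetD => /andP[].
    have := hallA (C :|: B); rewrite subUset sCA sBA => /(_ isT).
    rewrite cardsU (disjoint_setI0 dCB) cards0 subn0 bigcup_setU -/NB.
    set NC := \bigcup_(x in C) N x; rewrite -(cardsID NB (NC :|: NB)).
    have -> : (NC :|: NB) :&: NB = NB by rewrite setUC setUK.
    rewrite setDUl setDv setU0 cardNB addnC leq_add2l => /leq_trans; apply.
    apply/subset_leq_card/subsetP=> z; rewrite !inE => /andP[zNB /bigcupP[x xC zx]].
    by apply/bigcupP; exists x; rewrite // inE zNB.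
  exists (fun x => if x \in B then f1 x else f2 x) => [x y xA yA|x xA].
  + case: ifP => xB; case: ifP => yB.
    * exact: inj1.
    * move=> eqf; have : f2 y \in N y :\: NB by apply: mem2; rewrite inE yB.
      rewrite -eqf inE => /andP[/negP[]]; apply/bigcupP.
      by exists x => //; apply: mem1.
    * move=> eqf; have : f2 x \in N x :\: NB by apply: mem2; rewrite inE xB.
      rewrite eqf inE => /andP[/negP[]]; apply/bigcupP.
      by exists y => //; apply: mem1.
    * by apply: inj2; rewrite inE ?xB ?yB.
  + case: ifP => xB; first exact: mem1.
    have : f2 x \in N x :\: NB by apply: mem2; rewrite inE xB.
    by rewrite inE => /andP[].
- have [z0 z0N] : exists z0, z0 \in N x0.
    apply/set0Pn; rewrite -card_gt0.
    have := hallA [set x0]; rewrite sub1set x0A big_set1 cards1; exact.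
  have [|C sC|f inj mem] := IHn (fun x => N x :\ z0) (A :\ x0).
  + by apply: leq_trans leAn; rewrite [X in _ < X](cardsD1 x0) x0A.
  + have [->|C0] := eqVneq C set0; first by rewrite cards0.
    have pC : C \proper A.
      apply: sub_proper_trans sC _; exact: properD1.
    have : #|C| < #|\bigcup_(x in C) N x|.
      rewrite ltnNge; apply/negP=> h; case/negP: noB; apply/existsP.
      by exists C; rewrite pC C0.
    rewrite [X in _ < X](cardsD1 z0) => h.
    apply: (@leq_trans #|(\bigcup_(x in C) N x) :\ z0|).
      by move: h; case: (z0 \in _) => [|/ltnW //]; rewrite add1n ltnS.
    apply/subset_leq_card/subsetP=> z; rewrite !inE => /andP[zz /bigcupP[x xC zx]].
    by apply/bigcupP; exists x; rewrite // !inE zz.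
  exists (fun x => if x == x0 then z0 else f x) => [x y xA yA|x xA].
  + case: eqP => [->|/eqP xx]; case: eqP => [->|/eqP yy] //.
    * move=> eqf; have : f y \in N y :\ z0 by apply: mem; rewrite !inE yy.
      by rewrite -eqf !inE eqxx.
    * move=> eqf; have : f x \in N x :\ z0 by apply: mem; rewrite !inE xx.
      by rewrite eqf !inE eqxx.
    * by apply: inj; rewrite !inE ?xx ?yy.
  + case: eqP => [->|/eqP xx] //.
    have : f x \in N x :\ z0 by apply: mem; rewrite !inE xx.
    by rewrite inE => /andP[].
Qed.

Lemma sum_card_fibers (T : finType) (N : T -> {set T}) (B C : {set T}) :
  \sum_(x in B) #|N x :&: C| = \sum_(z in C) #|[set x in B | z \in N x]|.
Proof.
transitivity (\sum_(x in B) \sum_(z in C) (z \in N x : nat)).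
  apply: eq_bigr => x _; rewrite -sum1_card big_mkcond /= [RHS]big_mkcond /=.
  by apply: eq_bigr => z _; rewrite inE andbC; case: (z \in C); case: (z \in N x).
rewrite exchange_big; apply: eq_bigr => z _.
rewrite -sum1_card [RHS]big_mkcond [LHS]big_mkcond; apply: eq_bigr => x _.
by rewrite inE; case: (x \in B) => //=; case: (z \in N x).
Qed.

(** Double counting the edges between B and its neighbourhood gives the
    condition of [hall]. The factor m lets the degree bounds be fractions. *)
Lemma hall_degree (T : finType) (N : T -> {set T}) (A : {set T}) m c :
  0 < c -> {in A, forall x, c <= m * #|N x|} ->
  (forall z, m * #|[set x in A | z \in N x]| <= c) ->
  exists2 f : T -> T, {in A &, injective f} & {in A, forall x, f x \in N x}.
Proof.
move=> c0 degA degz; apply: hall => B sBA; set NB := \bigcup_(x in B) N x.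
rewrite -(leq_pmul2l c0).
apply: (@leq_trans (m * \sum_(x in B) #|N x :&: NB|)).
  rewrite mulnC -sum_nat_const big_distrr /=; apply: leq_sum => x xB.
  suff -> : N x :&: NB = N x by apply/degA/(subsetP sBA).
  by apply/setIidPl/bigcup_sup.
rewrite sum_card_fibers mulnC big_distrl /= [c * _]mulnC -sum_nat_const.
apply: leq_sum => z _; rewrite mulnC; apply: leq_trans (degz z).
rewrite leq_mul2l subset_leq_card ?orbT //.
by apply/subsetP=> x; rewrite !inE => /andP[/(subsetP sBA)->].
Qed.

(** * Splitting into levels *)

Section Levels.
Local Open Scope ring_scope.
Variables (T J : finType) (A : J -> {set T}) (m : nat).

(** A random level function has at most this expected squared deviation. Placing
    the points one at a time, each on a level where the cross term is nonpositive,
    does at least as well, so that no probability is needed. *)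
Lemma balanced_levels_seq (l : seq T) : uniq l ->
  exists s : T -> 'I_m.+1,
  \sum_j \sum_i ((m.+1 * count [pred x | (x \in A j) && (s x == i)] l)%:R
                 - (count (mem (A j)) l)%:R) ^+ 2
  <= (m.+1 ^ 2 * \sum_j count (mem (A j)) l)%:R :> int.
Proof.
elim: l => [_|x l IHl /= /andP[xl /IHl[s Hs]]].
  exists (fun _ => ord0); rewrite big1 // => j _; rewrite big1 // => i _.
  by rewrite /= muln0 subr0.
pose dev j i : int := (m.+1 * count [pred x | (x \in A j) && (s x == i)] l)%:R
                 - (count (mem (A j)) l)%:R.
have sum_dev j : \sum_i dev j i = 0.
  rewrite /dev big_split /= sumrN sumr_const card_ord.
  have -> : (count (mem (A j)) l = \sum_(i < m.+1)
      count [pred x | (x \in A j) && (s x == i)] l)%N.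
    elim: l {IHl xl Hs dev} => [|y l IH] /=; first by rewrite big1.
    rewrite big_split /= -IH; congr addn.
    case: (y \in A j) => /=; last by rewrite big1.
    by rewrite (bigD1 (s y)) //= eqxx big1 ?addn0 // => i /negPf; rewrite eq_sym => ->.
  by rewrite -natr_sum -big_distrr /= natrM mulr_natl subrr.
(* Each set has total deviation 0 over all levels, so some level has a
   nonpositive total over the sets containing x; that level receives x. *)
have [i0 Hi0] : exists i0, \sum_(j | x \in A j) dev j i0 <= 0.
  apply/existsP; apply: contraT => /existsPn h.
  have : 0 < \sum_(i0 : 'I_m.+1) \sum_(j | x \in A j) dev j i0.
    rewrite big_ord_recl ltr_pwDl ?sumr_ge0 // => [|i _]; last by rewrite ltW // ltNge.
    by rewrite ltNge.
  by rewrite exchange_big big1 ?ltxx.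
exists (fun y => if y == x then i0 else s y).
have cnt j i : count [pred y | (y \in A j) && ((if y == x then i0 else s y) == i)] l
    = count [pred x | (x \in A j) && (s x == i)] l.
  by apply: eq_in_count => y yl /=; case: (y =P x) => // yx; case/negP: xl; rewrite -yx.
have new j : \sum_i ((m.+1 * ((x \in A j) && ((if x == x then i0 else s x) == i) +
    count [pred y | (y \in A j) && ((if y == x then i0 else s y) == i)] l))%:R
    - ((x \in A j) + count (mem (A j)) l)%:R) ^+ 2
  <= \sum_i dev j i ^+ 2 + (x \in A j)%:R * (2 * m.+1%:R * dev j i0 + m.+1%:R ^+ 2).
  case: (boolP (x \in A j)) => xA /=; last first.
    by rewrite mul0r addr0; apply: ler_sum => i _; rewrite cnt.
  rewrite eqxx mul1r.
  have e i : ((m.+1 * ((i0 == i) +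
      count [pred y | (y \in A j) && ((if y == x then i0 else s y) == i)] l))%:R
    - (1 + count (mem (A j)) l)%:R) ^+ 2 =
    dev j i ^+ 2 - 2 * dev j i + 1 +
      (i0 == i)%:R * (2 * m.+1%:R * dev j i + m.+1%:R ^+ 2 - 2 * m.+1%:R) :> int.
    rewrite cnt /dev !natrM !natrD; case: (i0 == i); rewrite /=; ring.
  under eq_bigr do rewrite e.
  rewrite !big_split /= sumrN -mulr_sumr sum_dev mulr0 subr0.
  have -> : \sum_(i < m.+1) (1 : int) = m.+1%:R by rewrite sumr_const card_ord.
  rewrite [\sum_(i < _) _%:R * _](bigD1 i0) //= [X in _ + (_ + X)]big1 => [|i /negPf].
    by rewrite eqxx mul1r; have := ler0n int m.+1; set M := m.+1%:R; lra.
  by rewrite eq_sym => ->; rewrite mul0r.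
apply: le_trans (ler_sum _ (fun j _ => new j)) _.
rewrite big_split /= big_split /= mulnDr natrD addrC lerD //.
rewrite (bigID [pred j | x \in A j]) /= [X in _ + X]big1 ?addr0; last first.
  by move=> j /negPf->; rewrite mul0r.
rewrite (eq_bigr (fun j => 2 * m.+1%:R * dev j i0 + m.+1%:R ^+ 2)); last first.
  by move=> j ->; rewrite mul1r.
rewrite big_split /= -mulr_sumr sumr_const.
have -> : (\sum_j (x \in A j) = #|[pred j | x \in A j]|)%N.
  by rewrite -sum1_card [RHS]big_mkcond.
rewrite -[X in _ <= X]add0r lerD //; last by rewrite natrM natrX mulr_natr.
by rewrite mulr_ge0_le0 // mulr_ge0.
Qed.

Lemma balanced_levels :
  exists s : T -> 'I_m.+1,
  \sum_j \sum_i ((m.+1 * #|[set x in A j | s x == i]|)%:R - #|A j|%:R) ^+ 2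
  <= (m.+1 ^ 2 * \sum_j #|A j|)%:R :> int.
Proof.
have [s Hs] := balanced_levels_seq (enum_uniq T).
have cardc (p : pred T) : count p (enum T) = #|[set x | p x]|.
  by rewrite cardsE cardE enumT -size_filter.
have e1 j : count (mem (A j)) (enum T) = #|A j|.
  by rewrite cardc; apply: eq_card => x; rewrite inE.
have e2 j i : count [pred x | (x \in A j) && (s x == i)] (enum T) =
  #|[set x in A j | s x == i]| by rewrite cardc.
exists s; move: Hs; rewrite (eq_bigr _ (fun j _ => e1 j)); apply: le_trans.
rewrite le_eqVlt; apply/orP; left; apply/eqP/eq_bigr => j _; apply: eq_bigr => i _.
by rewrite e1 e2.
Qed.

(** Chebyshev's inequality for [balanced_levels]. *)
Lemma few_unbalanced b : exists s : T -> 'I_m.+1,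
  (#|[set j | [exists i : 'I_m.+1,
      (m.+1 * #|[set x in A j | s x == i]| + b < #|A j|) ||
      (#|A j| + b < m.+1 * #|[set x in A j | s x == i]|)]]| * b ^ 2
  <= m.+1 ^ 2 * \sum_j #|A j|)%N.
Proof.
have [s Hs] := balanced_levels; exists s.
rewrite -(ler_nat int); apply: le_trans Hs.
rewrite natrM mulr_natl -sumr_const big_mkcond /=; apply: ler_sum => j _.
rewrite inE; case: existsP => [[i hi]|_]; last by apply: sumr_ge0 => i _; exact: sqr_ge0.
rewrite (bigD1 i) //= -[X in X <= _]addr0 lerD //; last by apply: sumr_ge0 => k _; exact: sqr_ge0.
move: (m.+1 * _)%N #|A j| hi => u v; rewrite natrX => hi.
rewrite -[X in _ <= X]real_normK ?num_real // lerXn2r ?nnegrE //.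
by case/orP: hi; lia.
Qed.
End Levels.

(** * Balanced assignments *)

Definition load (T : finType) (f : T -> {set T}) z := #|[set x | z \in f x]|.

Section Assignment.
Variables (T : finType) (X : {set T}) (nb : T -> {set T}) (D K : nat).

(** The empty value marks an x that receives nothing. *)
Definition assignment (f : T -> {set T}) := [forall x,
  (f x == set0) || [&& x \in X, #|f x| == D & f x \subset nb x]].

(** The convex weight [2 ^ load] makes an optimal assignment spread its load
    as evenly as the graph permits, up to one unit; K is the price of leaving a
    vertex unassigned. *)
Definition cost (f : T -> {set T}) :=
  \sum_z 2 ^ load f z + \sum_(x in X) (f x == set0) * K.

Definition load_off (f : T -> {set T}) x z := #|[set y | (y != x) && (z \in f y)]|.

Lemma loadE f x z : load f z = (z \in f x) + load_off f x z.
Proof.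
rewrite /load (cardsD1 x) inE; congr addn; apply: eq_card => y.
by rewrite !inE.
Qed.

Lemma costE f x : x \in X ->
  cost f = (\sum_z 2 ^ load_off f x z + \sum_(y in X | y != x) (f y == set0) * K)
           + (\sum_(z in f x) 2 ^ load_off f x z + (f x == set0) * K).
Proof.
move=> xX; rewrite /cost [\sum_(x in X) _](bigD1 x) //=.
have -> : \sum_z 2 ^ load f z = \sum_z 2 ^ load_off f x z + \sum_(z in f x) 2 ^ load_off f x z.
  rewrite [X in _ = _ + X]big_mkcond -big_split; apply: eq_bigr => z _.
  rewrite (loadE f x) /=.
  by case: (z \in f x); rewrite ?add1n ?add0n ?expnS ?addn0 ?mul2n ?addnn.
lia.
Qed.

Definition reassign (f : T -> {set T}) x S : {ffun T -> {set T}} :=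
  [ffun y => if y == x then S else f y].

Lemma load_reassign f x S z : load_off (reassign f x S) x z = load_off f x z.
Proof. by apply: eq_card => y; rewrite !inE ffunE; case: (y == x). Qed.

Lemma optimal_assignment : exists2 f : {ffun T -> {set T}}, assignment f &
  forall x S, x \in X -> (S == set0) || [&& #|S| == D & S \subset nb x] ->
    \sum_(z in f x) 2 ^ load_off f x z + (f x == set0) * K <=
    \sum_(z in S) 2 ^ load_off f x z + (S == set0) * K.
Proof.
pose f0 : {ffun T -> {set T}} := [ffun => set0].
have af0 : assignment f0 by apply/forallP => x; rewrite ffunE eqxx.
have [f af opt] := @arg_minnP _ f0 (fun f : {ffun T -> {set T}} => assignment f)
  (fun f => cost f) af0.
exists f => // x S xX admS.
have aS : assignment (reassign f x S).
  apply/forallP => y; rewrite ffunE; case: (y =P x) => [->|_]; last by move/forallP: af; apply.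
  by rewrite xX.
have := opt _ aS; rewrite (costE f xX) (costE _ xX).
under [X in _ <= _ + (X + _)]eq_bigr do rewrite load_reassign.
under [X in _ <= X + _ + _]eq_bigr do rewrite load_reassign.
rewrite [X in _ <= _ + X + _](eq_bigr (fun y => (f y == set0) * K)); last first.
  by move=> y /andP[_ /negPf yx]; rewrite ffunE yx.
by rewrite leq_add2l ffunE eqxx.
Qed.
End Assignment.

(** Local optimality for [cost] with K = D * 2 ^ D' is all that is needed:
    dropping x shows that no load on f x is much above D', exchanging one
    neighbour of x for another shows that the loads around x differ by at most
    one, and assigning an unassigned x shows that nearly all of its neighbours
    already carry load D'. *)
Lemma load_balancing (T : finType) (X : {set T}) (nb : T -> {set T}) D D' :
  0 < D -> 0 < D' ->
  exists f : T -> {set T},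
  [/\ forall x, f x = set0 \/ [/\ x \in X, #|f x| = D & f x \subset nb x],
      forall x z, z \in f x -> 2 ^ (load f z).-1 <= D * 2 ^ D',
      forall x z z', z \in f x -> z' \in nb x -> z' \notin f x ->
        load f z <= (load f z').+1 &
      forall x, x \in X -> f x = set0 -> #|[set z in nb x | load f z < D']| < D].
Proof.
move=> D0 D'0; have [f /forallP af opt] := optimal_assignment X nb D (D * 2 ^ D').
have fX x : f x != set0 -> [/\ x \in X, #|f x| = D & f x \subset nb x].
  by case/orP: (af x) => [->//|/and3P[-> /eqP -> ->]].
have f0 x z : z \in f x -> f x != set0 by move=> zx; apply/set0Pn; exists z.
exists f; split.
- move=> x; case: (eqVneq (f x) set0) => [|/fX]; [by left|by right].
- move=> x z zx; have fx0 := f0 _ _ zx; have [xX _ _] := fX x fx0.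
  have := opt x set0 xX; rewrite eqxx => /(_ isT).
  rewrite (negPf fx0) big_set0 mul0n addn0 mul1n add0n; apply: leq_trans.
  by rewrite (loadE f x) zx (bigD1 z) //= leq_addr.
- move=> x z z' zx z'nb z'x; have fx0 := f0 _ _ zx; have [xX cfx sfx] := fX x fx0.
  have z'z : z' \notin f x :\ z by rewrite inE negb_and z'x orbT.
  have := opt x (z' |: f x :\ z) xX.
  have cS : #|z' |: f x :\ z| = D.
    by rewrite cardsU1 z'z -cfx (cardsD1 z (f x)) zx.
  have /negPf S0 : z' |: f x :\ z != set0 by rewrite -card_gt0 cS.
  rewrite S0 cS eqxx subUset sub1set z'nb (subset_trans (subsetDl _ _) sfx).
  move=> /(_ isT); rewrite (negPf fx0) !mul0n !addn0 big_setU1 //=.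
  rewrite (big_setD1 z) //= leq_add2r leq_exp2l // (loadE f x z) zx (loadE f x z').
  by rewrite (negPf z'x).
- move=> x xX fx0; rewrite ltnNge; apply/negP => /card_geqP[s [us ss sS]].
  pose S := [set z in s].
  have cS : #|S| = D by rewrite cardsE (card_uniqP us).
  have := opt x S xX; rewrite cS eqxx /= fx0 eqxx big_set0.
  have /negPf-> : S != set0 by rewrite -card_gt0 cS.
  have -> : S \subset nb x.
    by apply/subsetP=> z; rewrite inE => /sS; rewrite inE => /andP[].
  move=> /(_ isT); rewrite mul0n addn0 add0n mul1n.
  apply/negP; rewrite -ltnNge.
  apply: (@leq_ltn_trans (D * 2 ^ D'.-1)); last first.
    by rewrite ltn_pmul2l // ltn_exp2l // prednK.
  rewrite -cS -sum_nat_const; apply: leq_sum => z; rewrite inE => /sS.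
  rewrite inE => /andP[_]; rewrite (loadE f x) fx0 inE add0n => h.
  by rewrite leq_exp2l // -ltnS prednK.
Qed.

Lemma sum_load (T : finType) (f : T -> {set T}) (C : {set T}) :
  \sum_(z in C) load f z = \sum_x #|f x :&: C|.
Proof.
have -> : \sum_x #|f x :&: C| = \sum_(x in [set: T]) #|f x :&: C|.
  by apply: eq_bigl => x; rewrite inE.
rewrite sum_card_fibers; apply: eq_bigr => z _.
by apply: eq_card => x; rewrite !inE.
Qed.

(** An approximate form of the theorem of Koenig on matchings and covers. Fix a
    threshold h slightly below D', let N be the set of vertices of load at least
    h, and let Y collect the unassigned vertices and those assigned to
    some load above h. By [load_balancing] a vertex of Y sees only N, apart from
    at most D neighbours. The assignment edges into loads above h all come
    from Y, which bounds N by the assigned part of Y, up to the vertices whose load is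
    exactly h; h is chosen among 4 q values so that there are few of those. *)
Lemma assignment_or_cover (T : finType) (X : {set T}) (nb : T -> {set T}) D D' q g :
  0 < q -> 4 * q * (D - D' + 4 * q) <= D -> D' <= D -> D <= 2 ^ g ->
  exists (f : T -> {set T}) (Y N : {set T}),
  [/\ forall x, f x = set0 \/ [/\ x \in X, #|f x| = D & f x \subset nb x],
      forall z, load f z <= D' + g.+1,
      Y \subset X,
      forall x, x \in Y -> #|nb x :\: N| <= D &
      q * (#|N| + #|[set x in X | f x == set0]|) <=
      q * #|Y| + #|[set x | f x != set0]|].
Proof.
move=> q0 hD leD'D leDg.
have D0 : 0 < D by nia.
have D'0 : 0 < D' by nia.
have wD' : 4 * q < D' by nia.
have [f [f1 f2 f3 f4]] := load_balancing X nb D0 D'0.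
set U := [set x in X | f x == set0]; set Xs := [set x | f x != set0].
have sumf : \sum_x #|f x| = D * #|Xs|.
  rewrite (bigID (mem Xs)) /= [X in _ + X]big1 => [|x]; last first.
    by rewrite inE negbK => /eqP->; rewrite cards0.
  rewrite addn0 mulnC -sum_nat_const; apply: eq_bigr => x.
  by rewrite inE; case: (f1 x) => [->|[]]; rewrite ?eqxx.
pose N h := [set z | h <= load f z].
pose L h := [set z | load f z == h].
(* The classes of equal load are disjoint, so their loads add up to at most the
   size of the assignment; one of 4 q classes carries at most a fraction of it. *)
have sumL : \sum_(k < 4 * q) (D' - 4 * q) * #|L (D' - k)| <= D * #|Xs|.
  rewrite -sumf.
  have -> : \sum_x #|f x| = \sum_z load f z.
    transitivity (\sum_(z in [set: T]) load f z); last by apply: eq_bigl => z; rewrite inE.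
    by rewrite sum_load; apply: eq_bigr => x _; rewrite setIT.
  apply: (@leq_trans (\sum_(k < 4 * q) \sum_z (load f z == D' - k) * load f z)).
    apply: leq_sum => k _; rewrite mulnC -sum_nat_const big_mkcond /=.
    apply: leq_sum => z _; rewrite inE; case: eqP => //= ->.
    by rewrite mul1n leq_sub2l // ltnW.
  rewrite exchange_big; apply: leq_sum => z _; rewrite -big_distrl /=.
  rewrite -[X in _ <= X]mul1n leq_mul2r; apply/orP; right.
  case: (boolP [exists k : 'I_(4 * q), load f z == D' - k]) => [/existsP[k /eqP zk]|].
    rewrite (bigD1 k) //= big1 ?addn0 ?leq_b1 // => j jk.
    apply/eqP; rewrite eqb0 zk; apply: contra jk => /eqP ejk; rewrite -val_eqE; apply/eqP => /=.
    by have := ltn_ord j; have := ltn_ord k; lia.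
  by rewrite negb_exists => /forallP h; rewrite big1 // => k _; rewrite (negPf (h k)).
have /existsP[k Hk] : [exists k : 'I_(4 * q),
    4 * q * ((D' - 4 * q) * #|L (D' - k)|) <= D * #|Xs|].
  apply: contraT => /existsPn h.
  have : \sum_(k < 4 * q) (D * #|Xs|).+1 <=
      \sum_(k < 4 * q) 4 * q * ((D' - 4 * q) * #|L (D' - k)|).
    by apply: leq_sum => k _; rewrite ltnNge.
  rewrite sum_nat_const card_ord -big_distrr /= leq_pmul2l ?muln_gt0 //.
  by move=> /leq_trans /(_ sumL); rewrite ltnn.
set h := D' - k in Hk *; have hD' : D' - 4 * q < h by rewrite /h; have := ltn_ord k; lia.
have hleD' : h <= D' by rewrite leq_subr.
pose Yh := [set x | [exists z in f x, h < load f z]].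
have UY : [disjoint U & Yh].
  rewrite disjoints_subset; apply/subsetP => x; rewrite !inE => /andP[_ /eqP ->].
  by apply/existsPn => z; rewrite inE.
have sYX : Yh \subset Xs.
  apply/subsetP => x; rewrite !inE => /existsP[z /andP[zx _]].
  by apply/set0Pn; exists z.
exists f, (U :|: Yh), (N h); split => //.
- move=> z; case: (posnP (load f z)) => [->//|lz].
  have : z \in \bigcup_x f x.
    move: lz; rewrite /load card_gt0 => /set0Pn[x]; rewrite inE => zx.
    by apply/bigcupP; exists x.
  case/bigcupP => x _ /f2 le2.
  have : 2 ^ (load f z).-1 <= 2 ^ (D' + g).
    by apply: leq_trans le2 _; rewrite addnC expnD leq_mul2r leDg orbT.
  by rewrite leq_exp2l //; lia.
- apply/subsetP => x; rewrite inE => /orP[|/(subsetP sYX)]; rewrite inE.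
    by case/andP.
  by case: (f1 x) => [->|[]]; rewrite ?eqxx.
- move=> x; rewrite inE => /orP[|].
    rewrite inE => /andP[xX /eqP fx0]; apply: leq_trans (ltnW (f4 x xX fx0)).
    apply/subset_leq_card/subsetP => z; rewrite !inE -ltnNge => /andP[zh ->] /=.
    exact: leq_trans zh hleD'.
  rewrite inE => /existsP[z /andP[zx hz]].
  case: (f1 x) => [fx0|[xX cfx _]]; first by rewrite fx0 inE in zx.
  rewrite -cfx; apply/subset_leq_card/subsetP => z'; rewrite !inE => /andP[z'h z'nb].
  apply: contraR z'h => z'x; have := f3 _ _ _ zx z'nb z'x; lia.
have cY : #|U :|: Yh| = #|U| + #|Yh| by rewrite cardsU (disjoint_setI0 UY) cards0 subn0.
(* Assignment edges into vertices of load above h come from Yh. *)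
have ubN : h * #|N h| <= D * #|Yh| + h * #|L h|.
  have -> : #|N h| = #|N h.+1| + #|L h|.
    rewrite -[#|N h|](cardsID (L h)) addnC; congr addn; apply: eq_card => z.
      by rewrite !inE ltn_neqAle eq_sym.
    by rewrite !inE andb_idl // => /eqP ->.
  rewrite mulnDr leq_add2r; apply: (@leq_trans (\sum_(z in N h.+1) load f z)).
    rewrite mulnC -sum_nat_const; apply: leq_sum => z; rewrite inE; exact: ltnW.
  rewrite sum_load (bigID (mem Yh)) /= [X in _ + X]big1 => [|x]; last first.
    rewrite inE => /existsPn h0; apply/eqP; rewrite cards_eq0; apply/eqP/setP => z.
    by rewrite !inE; apply/negbTE/h0.
  rewrite addn0 mulnC -sum_nat_const; apply: leq_sum => x _.
  apply: leq_trans (subset_leq_card (subsetIl _ _)) _.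
  by case: (f1 x) => [->|[_ -> _]]; rewrite ?cards0.
have ubN2 : h * #|N h| <= D * #|Xs|.
  rewrite -sumf; apply: (@leq_trans (\sum_(z in N h) load f z)).
    rewrite mulnC -sum_nat_const; apply: leq_sum => z; rewrite inE; exact.
  by rewrite sum_load; apply: leq_sum => x _; rewrite subset_leq_card // subsetIl.
rewrite cY !mulnDr.
rewrite [X in X <= _]addnC -addnA leq_add2l.
rewrite -(leq_pmul2l D0) mulnDr.
clearbody h; clear -q0 hD leD'D D0 D'0 Hk hD' hleD' ubN ubN2.
move: #|N h| #|Yh| #|Xs| #|L h| Hk ubN ubN2 => n y s l Hk ubN ubN2.
have hD1 : 4 * (D - D' + 4 * q) <= D by apply: leq_trans hD; rewrite leq_mul2r leq_pmulr ?orbT.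
have hD2 : D <= 2 * h by lia.
have hN : n <= 2 * s.
  rewrite -(leq_pmul2l D0) mulnCA; apply: leq_trans (_ : 2 * h * n <= _).
    by rewrite leq_mul2r hD2 orbT.
  by rewrite -mulnA leq_mul2l.
have e1 : 2 * (q * (h * l)) <= D * s.
  have : h * l <= 2 * ((D' - 4 * q) * l) by rewrite mulnA leq_mul2r; apply/orP; right; lia.
  by move: Hk; move: ((D' - 4 * q) * l) (h * l) => a b Hk /(leq_mul (leqnn (4 * q))); lia.
have e2 : 2 * (q * (D - h) * n) <= D * s.
  have hq : 4 * (q * (D - h)) <= D.
    by apply: leq_trans hD; rewrite mulnA leq_mul2l; apply/orP; right; lia.
  by have := leq_mul hq hN; move: (D - h) => a; lia.
have -> : D * (q * n) = q * (h * n) + q * (D - h) * n.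
  rewrite mulnCA -mulnA -mulnDr -mulnDl subnKC //; lia.
have : q * (h * n) <= q * (D * y + h * l) by rewrite leq_pmul2l.
lia.
Qed.

(** * From assignments to path forests *)

Lemma pigeonhole_fiber (T : finType) m (t : T -> 'I_m.+1) (S : {set T}) :
  exists i, m.+1 * #|[set x in S | t x == i]| <= #|S|.
Proof.
apply/existsP; apply: contraT => /existsPn h.
have : \sum_(i < m.+1) #|S|.+1 <= \sum_(i < m.+1) m.+1 * #|[set x in S | t x == i]|.
  by apply: leq_sum => i _; rewrite ltnNge.
rewrite sum_nat_const card_ord -big_distrr /= leq_pmul2l //.
have -> : \sum_(i < m.+1) #|[set x in S | t x == i]| = #|S|.
  rewrite -sum1_card (partition_big t xpredT) //=; apply: eq_bigr => i _.
  by rewrite -sum1_card; apply: eq_bigl => x; rewrite inE.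
by rewrite ltnn.
Qed.

(** Every assigned x has D neighbours in f x, which is more than any load, so
    that Hall's theorem saturates the assigned vertices. Spreading both sides
    over m + 1 levels keeps this comparison of degrees between any two levels,
    outside few exceptional vertices. Then x is matched once inside its own
    level and once with the next level; in a union of two such matchings every
    cycle runs through all levels, so deleting the smallest level class i0
    leaves no cycle. *)
Lemma levelled_matchings (T : finType) (f : T -> {set T}) D b m q :
  (forall x, f x = set0 \/ #|f x| = D) ->
  (forall z, load f z + 3 * b <= D) ->
  0 < b -> 4 * q <= m.+1 ->
  4 * q * m.+1 ^ 2 * D <= b ^ 2 -> 4 * q * m.+1 ^ 3 * D ^ 2 <= b ^ 3 ->
  exists (s t : T -> 'I_m.+1) (i0 : 'I_m.+1) (G : {set T}) (l r : T -> T),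
  let Xs := [set x | f x != set0] in
  [/\ {in G &, injective l} /\ {in G &, injective r},
      {in G, forall x, l x \in f x /\ r x \in f x},
      {in G, forall x, s (l x) = t x /\ s (r x) = ordS (t x)},
      {in G, forall x, t x != i0} &
      G \subset Xs /\ 4 * q * #|Xs :\: G| <= 3 * #|Xs|].
Proof.
move=> fD ldD b0 qm h2 h3; set Xs := [set x | f x != set0].
have fcard x : x \in Xs -> #|f x| = D.
  by rewrite inE; case: (fD x) => [->|//]; rewrite eqxx.
have sumf : \sum_x #|f x| = D * #|Xs|.
  rewrite (bigID (mem Xs)) /= [X in _ + X]big1 => [|x]; last first.
    by rewrite inE negbK => /eqP->; rewrite cards0.
  by rewrite addn0 mulnC -sum_nat_const; apply: eq_bigr => x /fcard.
have sumfib : \sum_z #|[set x | z \in f x]| = D * #|Xs|.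
  have := sum_load f [set: T].
  under [X in _ = X]eq_bigr do rewrite setIT.
  by rewrite sumf => <-; apply: eq_bigl => z; rewrite inE.
have [s Hs] := few_unbalanced f m b; rewrite sumf in Hs.
have [t Ht] := few_unbalanced (fun z => [set x | z \in f x]) m b; rewrite sumfib in Ht.
set B1 := [set j | _] in Hs; set BZ := [set j | _] in Ht.
have [i0 Hi0] := pigeonhole_fiber t Xs.
set B2 := [set x in Xs | b < m.+1 * #|f x :&: BZ|].
set B3 := [set x in Xs | t x == i0] in Hi0.
pose G := Xs :\: (B1 :|: B2 :|: B3).
have b1P : 4 * q * #|B1| <= #|Xs|.
  have : 4 * q * (#|B1| * b ^ 2) <= #|Xs| * b ^ 2.
    apply: leq_trans (leq_mul (leqnn _) Hs) _.
    by rewrite mulnC [_ * b ^ 2]mulnC; apply: leq_trans (leq_mul h2 (leqnn _)); lia.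
  by rewrite mulnA leq_pmul2r // expn_gt0 b0.
have b2P : 4 * q * #|B2| <= #|Xs|.
  have e1 : #|B2| * b <= m.+1 * (D * #|BZ|).
    rewrite -sum_nat_const; apply: (@leq_trans (\sum_(x in B2) m.+1 * #|f x :&: BZ|)).
      by apply: leq_sum => x; rewrite inE => /andP[_ /ltnW].
    rewrite -big_distrr leq_mul2l; apply/orP; right.
    apply: (@leq_trans (\sum_x #|f x :&: BZ|)).
      by rewrite big_mkcond; apply: leq_sum => x _; case: ifP.
    rewrite -sum_load mulnC -sum_nat_const; apply: leq_sum => z _.
    exact: leq_trans (leq_addr _ _) (ldD z).
  have e2 : #|B2| * b ^ 3 <= m.+1 ^ 3 * D ^ 2 * #|Xs|.
    have : #|B2| * b * b ^ 2 <= m.+1 * D * (#|BZ| * b ^ 2).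
      by apply: leq_trans (leq_mul e1 (leqnn _)) _; lia.
    move=> /leq_trans /(_ (leq_mul (leqnn _) Ht)); rewrite -mulnA -expnS.
    move/leq_trans; apply; rewrite [m.+1 ^ 3]expnS !expnS !expn0; lia.
  have : 4 * q * (#|B2| * b ^ 3) <= #|Xs| * b ^ 3.
    apply: leq_trans (leq_mul (leqnn _) e2) _.
    by rewrite mulnC [_ * b ^ 3]mulnC; apply: leq_trans (leq_mul h3 (leqnn _)); lia.
  by rewrite mulnA leq_pmul2r // expn_gt0 b0.
have b3P : 4 * q * #|B3| <= #|Xs|.
  by apply: leq_trans Hi0; rewrite leq_mul2r qm orbT.
have GXs : G \subset Xs by apply: subsetDl.
have lossP : 4 * q * #|Xs :\: G| <= 3 * #|Xs|.
  have : #|Xs :\: G| <= #|B1| + #|B2| + #|B3|.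
    apply: (@leq_trans #|B1 :|: B2 :|: B3|).
      by rewrite /G setDDr setDv set0U subset_leq_card ?subsetIr.
    by apply: leq_trans (leq_card_setU _ _) _; rewrite leq_add2r leq_card_setU.
  by move/(leq_mul (leqnn (4 * q))) => /leq_trans; apply; lia.
(* D - 2 * b separates the degrees on the two sides, for both matchings. *)
have c0 : 0 < D - 2 * b \/ G = set0.
  case: (set_0Vmem G) => [|[x /setDP[/fcard fx _]]]; [by right | left].
  have [z zx] : exists z, z \in f x.
    apply/set0Pn; rewrite -card_gt0 fx; have := ldD x; lia.
  have := ldD z; have : 0 < load f z.
    by rewrite /load card_gt0; apply/set0Pn; exists x; rewrite inE.
  lia.
have matching (sh : 'I_m.+1 -> 'I_m.+1) : injective sh ->
    exists2 l : T -> T, {in G &, injective l} &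
      {in G, forall x, l x \in [set z in f x | (s z == sh (t x)) && (z \notin BZ)]}.
  move=> shI; case: c0 => [c0|G0]; last first.
    by exists id => [x y|x]; rewrite G0 in_set0.
  apply: (@hall_degree _ _ _ m.+1 (D - 2 * b)) => // [x|z].
  - rewrite /G !inE !negb_or => /andP[/andP[/andP[xB1 xB2] _] xs].
    have fx : #|f x| = D by apply: fcard; rewrite inE.
    have : m.+1 * #|[set z in f x | s z == sh (t x)]| + b >= D.
      rewrite -fx leqNgt; move: xB1; rewrite negb_exists => /forallP /(_ (sh (t x))).
      by rewrite negb_or => /andP[].
    have : m.+1 * #|f x :&: BZ| <= b.
      by move: xB2; rewrite negb_and xs /= -leqNgt.
    have : #|[set z in f x | s z == sh (t x)]| <=
      #|[set z in f x | (s z == sh (t x)) && (z \notin BZ)]| + #|f x :&: BZ|.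
      rewrite -(cardsID BZ) addnC leq_add //; apply/subset_leq_card/subsetP => z.
        by rewrite !inE => /and3P[-> -> ->].
      by rewrite !inE => /andP[/andP[-> _] ->].
    move/(leq_mul (leqnn m.+1)); rewrite mulnDr.
    by move: (m.+1 * _) (m.+1 * _) (m.+1 * _) => u v w; lia.
  - case: (boolP (z \in BZ)) => zB.
      rewrite (_ : [set x in G | _] = set0) ?cards0 ?muln0 //.
      by apply/setP => x; rewrite in_set0 2!in_set zB !andbF.
    case: (set_0Vmem
      [set x in G | z \in [set z in f x | (s z == sh (t x)) && (z \notin BZ)]]) => [->|[x0]].
      by rewrite cards0 muln0.
    rewrite !inE => /and3P[_ _ /andP[/eqP sz _]].
    move: (zB); rewrite inE negb_exists => /forallP /(_ (t x0)).
    rewrite negb_or => /andP[_]; rewrite -leqNgt => hz.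
    have := ldD z; rewrite /load => hld.
    apply: (@leq_trans (m.+1 * #|[set x in [set x | z \in f x] | t x == t x0]|)); last first.
      by move: hz; move: (m.+1 * _) => u; lia.
    rewrite leq_mul2l; apply/orP; right; apply/subset_leq_card/subsetP => x.
    rewrite !inE => /and3P[_ -> /andP[/eqP szx _]] /=.
    by apply/eqP/shI; rewrite -szx.
have [l lI lP] := matching id (fun _ _ e => e).
have [r rI rP] := matching (@ordS m.+1) (@ordS_inj m.+1).
exists s, t, i0, G, l, r; split => // [x xG|x xG|x].
- by have := lP x xG; have := rP x xG; rewrite !inE => /andP[-> _] /andP[-> _].
- by have := lP x xG; have := rP x xG; rewrite !inE => /and3P[_ /eqP-> _] /and3P[_ /eqP-> _].
- by rewrite !inE !negb_or => /andP[/andP[_ h] fx]; move: h; rewrite fx.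
Qed.

Definition path_between (T : Type) (e : rel T) (P : pred T) (p : seq T) :=
  if p is x :: p' then [&& P x, P (last x p') & path e x p'] else false.

Section Joining.
Variables (T : finType) (e : rel T) (Z : {set T}) (l r : T -> T) (rk : T -> nat).

(** The vertices of Z are the initial paths, and each x of G joins the path
    that ends in l x to the path that starts in r x. The rank increases along
    every path, so these two paths are different. *)
Lemma join_matchings (d : T) (G : {set T}) :
  [disjoint Z & G] -> {in G &, injective l} -> {in G &, injective r} ->
  {in G, forall x, [/\ l x \in Z, r x \in Z, e (l x) x & e x (r x)]} ->
  {in G, forall x, rk (l x) < rk (r x)} ->
  exists ps : seq (seq T),
  [/\ uniq (flatten ps), flatten ps =i Z :|: G, all (path_between e (mem Z)) ps,
      all (fun p => rk (head d p) <= rk (last d p)) ps &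
      {in Z, forall z, (z \notin [set l x | x in G] -> exists2 p, p \in ps & last d p = z) /\
                       (z \notin [set r x | x in G] -> exists2 p, p \in ps & head d p = z)}].
Proof.
have [n] := ubnP #|G|; elim: n => // n IHn in G *; rewrite ltnS => leGn dZG lI rI lrZ lrk.
have [->|[x xG]] := set_0Vmem G.
  exists [seq [:: z] | z <- enum Z].
  have -> : flatten [seq [:: z] | z <- enum Z] = enum Z.
    by elim: (enum Z) => //= z s ->.
  split; first exact: enum_uniq.
  - by move=> z; rewrite mem_enum !inE orbF.
  - by apply/allP => _ /mapP[z zZ ->] /=; rewrite -mem_enum zZ.
  - by apply/allP => _ /mapP[z zZ ->] /=.
  - by move=> z zZ; split=> _; exists [:: z] => //; apply: map_f; rewrite mem_enum.
have sG : G :\ x \subset G by apply: subsetDl.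
have inG y : y \in G :\ x -> y \in G by apply/subsetP.
have xZ : x \notin Z by apply: contraTN xG => xZ; rewrite (disjointFr dZG).
have [] := IHn (G :\ x).
- by apply: leq_trans leGn; rewrite [X in _ < X](cardsD1 x) xG.
- by apply: disjointWr dZG.
- by move=> y z yG zG; apply: lI; apply: inG.
- by move=> y z yG zG; apply: rI; apply: inG.
- by move=> y yG; apply/lrZ/inG.
- by move=> y yG; apply/lrk/inG.
move=> ps [ups psE psP psrk psends].
have [lZ rZ elx erx] := lrZ x xG.
have lxn : l x \notin [set l y | y in G :\ x].
  apply/imsetP => -[y]; rewrite !inE => /andP[/eqP yx yG] /lI h.
  by apply: yx; rewrite h.
have rxn : r x \notin [set r y | y in G :\ x].
  apply/imsetP => -[y]; rewrite !inE => /andP[/eqP yx yG] /rI h.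
  by apply: yx; rewrite h.
have [/(_ lxn)[p pps lp] _] := psends _ lZ.
have [_ /(_ rxn)[q qps hq]] := psends _ rZ.
have pq : q != p.
  apply/eqP => epq; have := lrk x xG; rewrite -lp -hq epq ltnNge.
  by move/allP: psrk => ->.
pose rest := rem q (rem p ps).
have perm_ps : perm_eq ps (p :: q :: rest).
  apply: perm_trans (perm_to_rem pps) _; rewrite perm_cons; apply: perm_to_rem.
  have := perm_mem (perm_to_rem pps) q; rewrite qps inE (negPf pq) /=.
  by move=> <-.
have perm_fl : perm_eq (flatten ((p ++ x :: q) :: rest)) (x :: flatten ps).
  rewrite [X in perm_eq _ X](_ : _ = [:: x] ++ flatten ps) //.
  rewrite perm_sym; apply: (@perm_trans _ ([:: x] ++ flatten (p :: q :: rest))).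
    by rewrite perm_cat2l; apply: perm_flatten.
  rewrite /= -catA /= perm_sym.
  exact: (permEl (perm_catCA p [:: x] (q ++ flatten rest))).
have memps c : c \in ps -> [\/ c = p, c = q | c \in rest].
  rewrite (perm_mem perm_ps) !inE => /orP[/eqP|/orP[/eqP|]];
    by [constructor 1|constructor 2|constructor 3].
have restps c : c \in rest -> c \in ps.
  by move=> crest; rewrite (perm_mem perm_ps) !inE crest !orbT.
have pP := allP psP p pps; have qP := allP psP q qps.
have hd : head d (p ++ x :: q) = head d p by case: (p) pP.
have ls : last d (p ++ x :: q) = last d q by rewrite last_cat /=; case: (q) qP.
exists ((p ++ x :: q) :: rest); split.
- rewrite (perm_uniq perm_fl) /= ups psE !inE negb_or xZ eqxx /=.
  by [].
- move=> z; rewrite (perm_mem perm_fl) !inE psE !inE.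
  by case: eqVneq => [->|]; rewrite ?xG ?orbT.
- rewrite /=; apply/andP; split; last by apply/allP => c /restps; apply: (allP psP).
  case: p q lp hq pP qP {pps qps pq memps rest restps perm_ps perm_fl hd ls} =>
    [//|u p] [//|v q] /= lp -> /and3P[Pu Plu pu] /and3P[Pv Plv pv].
  by rewrite Pu last_cat /= Plv cat_path /= pu lp elx erx pv.
- rewrite /= hd ls; apply/andP; split; last by apply/allP => c /restps; apply: (allP psrk).
  have := allP psrk p pps; have := allP psrk q qps; have := lrk x xG.
  rewrite lp hq => /ltnW lt_lr /= le_q le_p.
  exact: leq_trans le_p (leq_trans lt_lr le_q).
- move=> z zZ; have [zl zr] := psends z zZ; split=> zn.
  + have [|c cps lc] := zl.
      by apply: contra zn => /imsetP[y yG ->]; apply: imset_f; apply: inG.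
    case: (memps c cps) => [ecp|ecq|crest].
    * by case/negP: zn; rewrite -lc ecp lp; apply: imset_f.
    * by exists (p ++ x :: q); rewrite ?mem_head // ls -ecq.
    * by exists c => //; rewrite inE crest orbT.
  + have [|c cps lc] := zr.
      by apply: contra zn => /imsetP[y yG ->]; apply: imset_f; apply: inG.
    case: (memps c cps) => [ecp|ecq|crest].
    * by exists (p ++ x :: q); rewrite ?mem_head // hd -ecp.
    * by case/negP: zn; rewrite -lc ecq hq; apply: imset_f.
    * by exists c => //; rewrite inE crest orbT.
Qed.
End Joining.

(** Rotating the levels so that i comes last turns the cyclic successor into
    an increase, except at i itself. *)
Lemma rotated_level_lt m (i v : 'I_m.+1) : v != i ->
  (v + (m - i)) %% m.+1 < (ordS v + (m - i)) %% m.+1.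
Proof.
move=> vi; have := ltn_ord v; have := ltn_ord i => im vm.
rewrite /= modnDml; case: (ltngtP v i) => [lt|gt|/val_inj e]; last by rewrite e eqxx in vi.
  by rewrite !modn_small; lia.
have -> : v + (m - i) = m.+1 + (v - i.+1) by lia.
have -> : v.+1 + (m - i) = m.+1 + (v - i) by lia.
by rewrite !modnDl !modn_small; lia.
Qed.

(** Either almost all of X can be inserted between vertices of Z by a forest
    of paths with ends in Z, or the edges between X and Z have an obstruction:
    up to a bounded number of edges at each vertex, Y has only N as its
    neighbourhood, and N is smaller than Y by about the number of vertices of X
    that the forest misses. *)
Lemma forest_or_cover q : 0 < q -> exists K : nat,
  forall (T : finType) (d : T) (X Z : {set T}) (e : rel T),
  symmetric e -> [disjoint X & Z] ->
  exists (G Y N : {set T}) (ps : seq (seq T)),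
  [/\ G \subset X, uniq (flatten ps), flatten ps =i Z :|: G &
      all (path_between e (mem Z)) ps] /\
  [/\ Y \subset X, {in Y, forall x, #|[set z in Z | e x z] :\: N| <= K} &
      q * (#|N| + #|X :\: G|) <= q * #|Y| + #|X|].
Proof.
(* The imbalance b of the levels is negligible against D = 64 q b but exceeds
   the logarithm g of D, which bounds the excess of the loads over D'. *)
move=> q0; pose b := 2 ^ (6 * (16 * q)); pose D := 64 * q * b.
pose g := 64 * q + 6 * (16 * q); pose D' := D - (g.+1 + 3 * b).
exists D => T d X Z e e_sym dXZ.
have bq : (16 * q) ^ 6 <= b by rewrite /b [6 * _]mulnC expnM leq_exp2r //; apply/ltnW/ltn_expl.
have gb : g.+1 + 16 * q <= b.
  apply: (@leq_trans ((16 * q) ^ 2)); first by rewrite /g expnS expn1; nia.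
  by apply: leq_trans bq; rewrite leq_pexp2l // muln_gt0.
have b0 : 0 < b by rewrite expn_gt0.
have D'D : D' <= D by rewrite leq_subr.
have Dg : D <= 2 ^ g.
  rewrite /D /g expnD leq_mul2r; apply/orP; right; exact/ltnW/ltn_expl.
have hb : g.+1 + 3 * b <= D by rewrite /D; nia.
have hD : 4 * (4 * q) * (D - D' + 4 * (4 * q)) <= D.
  rewrite /D' subKn //; apply: (@leq_trans (16 * q * (4 * b))).
    by rewrite leq_mul; lia.
  by rewrite /D; lia.
have q4 : 0 < 4 * q by rewrite muln_gt0.
have [f [Y [N [f1 f2 YX YN card1]]]] :=
  assignment_or_cover X (fun x => [set z in Z | e x z]) q4 hD D'D Dg.
have [||||||s [t [i0 [G [l [r [[lI rI] lrf lrs ti0 [GXs card2]]]]]]]] :=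
  @levelled_matchings T f D b (4 * q).-1 q.
- by move=> x; case: (f1 x) => [|[]]; [left | right].
- by move=> z; have := f2 z; rewrite /D'; lia.
- by [].
- by rewrite prednK.
- rewrite prednK // /D; apply: (@leq_trans ((16 * q) ^ 5 * b)).
    rewrite mulnA leq_mul2r; apply/orP; right.
    have -> : (16 * q) ^ 5 = 16 * q * (16 * q) ^ 2 * ((16 * q) * (16 * q)) by ring.
    apply: leq_mul; first by apply: leq_mul; rewrite ?leq_exp2r ?leq_mul2r ?orbT.
    have -> : 64 * q = 4 * (16 * q) by rewrite mulnA.
    by rewrite leq_mul2r; apply/orP; right; apply: leq_trans (leq_pmulr 16 q0).
  by rewrite [b ^ 2]expnS expn1 leq_mul2r (leq_trans _ bq) ?orbT // leq_pexp2l ?muln_gt0.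
- rewrite prednK // /D; apply: (@leq_trans ((16 * q) ^ 6 * b ^ 2)).
    have -> : 4 * q * (4 * q) ^ 3 * (64 * q * b) ^ 2 = (4 * q) ^ 2 * (16 * q) ^ 4 * b ^ 2 by ring.
    by rewrite leq_mul2r [(16 * q) ^ 6](expnD _ 2 4) leq_mul2r leq_exp2r // leq_mul2r !orbT.
  by rewrite [b ^ 3]expnS leq_mul2r bq orbT.
have Xs : [set x | f x != set0] \subset X.
  by apply/subsetP => x; rewrite inE; case: (f1 x) => [->|[]]; rewrite ?eqxx.
have GX : G \subset X := subset_trans GXs Xs.
have fnb x z : z \in f x -> (z \in Z) && e x z.
  case: (f1 x) => [->|[_ _ /subsetP h] /h]; by rewrite inE.
have [|||||ps [ups psE psP _ _]] :=
  @join_matchings T e Z l r (fun z => (s z + ((4 * q).-1 - i0)) %% (4 * q).-1.+1) d G.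
- by rewrite disjoint_sym; apply: disjointWl dXZ.
- by [].
- by [].
- move=> x xG; have [/fnb/andP[-> h1] /fnb/andP[-> h2]] := lrf x xG.
  by rewrite e_sym h1 h2.
- by move=> x xG; have [-> ->] := lrs x xG; apply/rotated_level_lt/ti0.
exists G, Y, N, ps; split; split => //.
rewrite -(leq_pmul2l (_ : 0 < 4)) // mulnA.
have -> : #|X :\: G| = #|[set x in X | f x == set0]| + #|[set x | f x != set0] :\: G|.
  rewrite -[LHS](cardsID [set x | f x == set0]); congr addn; apply: eq_card => x.
    rewrite !inE; case: (boolP (x \in G)) => //= xG.
    by move/subsetP: GXs => /(_ x xG); rewrite inE => /negPf->; rewrite andbF.
  rewrite !inE; case: (boolP (x \in X)) => xX; first by rewrite andbT andbC.
  rewrite !andbF; apply/esym/negP => /andP[_ fx].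
  by case/negP: xX; apply: (subsetP Xs); rewrite inE.
have Xsle := subset_leq_card Xs.
rewrite addnA mulnDr; apply: leq_trans (leq_add card1 card2) _.
by rewrite mulnDr mulnA -addnA leq_add2l -mulSn leq_mul2l Xsle.
Qed.

(** * Monochromatic path forests in the natural numbers *)

(** Every pair in Q x P is counted at one of its two ends, so P and Q have at
    most K (|P| + |Q|) pairs. *)
Lemma one_side_small (T : finType) (P Q : {set T}) (e : rel T) K :
  {in Q, forall x, #|[set z in P | e x z]| <= K} ->
  {in P, forall z, #|[set x in Q | ~~ e x z]| <= K} ->
  #|P| <= 2 * K \/ #|Q| <= 2 * K.
Proof.
move=> hQ hP.
have : #|Q| * #|P| <= #|Q| * K + #|P| * K.
  rewrite -!sum_nat_const.
  apply: (@leq_trans (\sum_(x in Q) (#|[set z in P | e x z]| + #|[set z in P | ~~ e x z]|))).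
    apply: leq_sum => x _; rewrite -(cardsID [set z | e x z]) leq_add //.
      by apply/subset_leq_card/subsetP => z; rewrite !inE.
    by apply/subset_leq_card/subsetP => z; rewrite !inE andbC.
  rewrite big_split leq_add //=; first exact: leq_sum.
  have := sum_card_fibers (fun x => [set z | ~~ e x z]) Q P => h.
  rewrite (eq_bigr (fun x => #|[set z | ~~ e x z] :&: P|)); last first.
    by move=> x _; apply: eq_card => z; rewrite !inE andbC.
  rewrite h; apply: leq_sum => z zP; apply: leq_trans (hP z zP).
  by apply/subset_leq_card/subsetP => x; rewrite !inE.
case: (leqP #|P| (2 * K)) => [|p]; [by left | case: (leqP #|Q| (2 * K)) => [|q]; [by right|]].
nia.
Qed.

Definition colour_forest (col : rel nat) (chi : nat -> bool) (k : bool) (ps : seq (seq nat)) :=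
  uniq (flatten ps) &&
  all (path_between (fun u v => col u v == k) (fun v => chi v == k)) ps.

Lemma count_initial (b t : nat) : (t <= b)%N ->
  #|[set v : 'I_b.+1 | (0 < v <= t)%N]| = t.
Proof.
move=> tb; rewrite cardE -(size_map val).
rewrite -[RHS](size_iota 1); apply: perm_size; apply: uniq_perm.
- by rewrite map_inj_uniq ?enum_uniq //; apply: val_inj.
- exact: iota_uniq.
- move=> v; rewrite mem_iota add1n ltnS; apply/mapP/idP => [[u]|hv].
    by rewrite mem_enum inE => h ->.
  have vb : v < b.+1 by rewrite ltnS; case/andP: hv => _ /leq_trans; apply.
  by exists (Ordinal vb); rewrite ?mem_enum ?inE.
Qed.

(** The colour of u is the colour of its edges to almost all vertices, with
    respect to a nonprincipal ultrafilter. *)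
Lemma common_neighbours (col : rel nat) : exists chi : nat -> bool,
  forall u v n, chi u = chi v ->
    exists2 w, n <= w & (col u w == chi u) && (col v w == chi u).
Proof.
have [U [UU sU]] := ultraFilterLemma (F := (\oo)%classic) _.
have Ucol u : U [set w | col u w == `[< U [set w | col u w]%classic >]]%classic.
  case: asboolP => [h|nh].
    by apply: filterS h => w /= ->.
  have [//|] := in_ultra_setVsetC [set w | col u w]%classic UU.
  by apply: filterS => w /= /negP/negPf->.
exists (fun u => `[< U [set w | col u w]%classic >]) => u v n uv.
have Un : U [set w | n <= w]%classic by apply: sU; exists n.
have [w [/= nw [hu hv]]] := filter_ex (filterI Un (filterI (Ucol u) (Ucol v))).
exists w => //.
by rewrite hu {1}uv hv.
Qed.

Definition monochromatic_path (col : rel nat) (chi : nat -> bool) k x p :=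
  [&& uniq (x :: p), path (fun u v => col u v == k) x p, chi (last x p) == k
    & all (fun v => 0 < v) (x :: p)].

(** Since both ends of each path in the forest have vertex colour k, a fresh
    common neighbour links the end of the current path to the next one. *)
Lemma extend_by_forest (col : rel nat) (chi : nat -> bool) k :
  symmetric col ->
  (forall u v n, chi u = chi v ->
    exists2 w, n <= w & (col u w == chi u) && (col v w == chi u)) ->
  forall ps x p,
  monochromatic_path col chi k x p -> colour_forest col chi k ps ->
  all [pred v | (0 < v) && (v \notin x :: p)] (flatten ps) ->
  exists2 q, monochromatic_path col chi k x (p ++ q) & {subset flatten ps <= q}.
Proof.
move=> col_sym nbr; elim=> [|[|y c] ps IHps] x p; first by exists [::]; rewrite ?cats0.
  by move=> _ /andP[_ /=].
move=> /and4P[up pp lp p0] /andP[ufl allps] avoid.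
move: (allps) => /= /andP[/and3P[yk lk pc] psk].
pose B := (\sum_(v <- x :: p ++ flatten ((y :: c) :: ps)) v).+1.
have ltB v : v \in x :: p ++ flatten ((y :: c) :: ps) -> v < B.
  by move=> vin; rewrite /B ltnS (big_rem v) //= leq_addr.
have [w Bw /andP[cw1 cw2]] : exists2 w, B <= w & (col (last x p) w == k) && (col y w == k).
  by have [|w h1 h2] := nbr (last x p) y B;
    [rewrite (eqP lp) (eqP yk) | exists w; rewrite -?(eqP lp)].
have wfresh : w \notin x :: p ++ flatten ((y :: c) :: ps).
  by apply/negP => /ltB; rewrite ltnNge Bw.
have fl : flatten ((y :: c) :: ps) = (y :: c) ++ flatten ps by [].
have uall : uniq ((x :: p) ++ [:: w & y :: c] ++ flatten ps).
  rewrite -(perm_uniq (permEl (perm_catCA [:: w] (x :: p) ((y :: c) ++ flatten ps)))).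
  rewrite cat1s cons_uniq; apply/andP; split; first exact: wfresh.
  rewrite cat_uniq up ufl andbT; apply/hasPn => v vin.
  by case/andP: (allP avoid v vin).
have x0 : all (fun v => 0 < v) ((x :: p) ++ [:: w & y :: c]).
  rewrite all_cat p0; apply/allP => v; rewrite inE => /orP[/eqP->|vyc].
    exact: leq_trans Bw.
  have /andP[//] : [pred v | (0 < v) && (v \notin x :: p)] v.
  by apply: (allP avoid); rewrite fl mem_cat vyc.
have [|||q qP qs] := IHps x (p ++ [:: w & y :: c]).
- apply/and4P; split.
  + by move: uall; rewrite catA cat_uniq => /andP[].
  + by rewrite cat_path pp /= cw1 col_sym cw2 pc.
  + by rewrite last_cat.
  + exact: x0.
- by rewrite /colour_forest psk andbT; move: ufl; rewrite fl cat_uniq => /and3P[].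
- apply/allP => v vps /=; apply/andP; split.
    by have := allP avoid v; rewrite fl mem_cat vps orbT => /(_ isT) /andP[].
  move: uall; rewrite catA cat_uniq => /and3P[_ /hasPn h _].
  exact: h.
exists ([:: w & y :: c] ++ q); first by rewrite catA.
move=> v; rewrite -[y :: _]/((y :: c) ++ flatten ps) mem_cat.
by rewrite -[[:: w & y :: c]]cat1s !mem_cat => /orP[->|/qs->]; rewrite !orbT.
Qed.

Local Open Scope ring_scope.

(** * Two interleaved sequences *)

Section Oscillation.
Variables (R : realType) (c : R).

Definition interleaved (a b : nat) (y y' : nat -> R) :=
  forall t s, (a <= t <= b)%N -> (a <= s <= b)%N ->
    y t + c * s%:R <= y' s \/ y' s + c * t%:R <= y t.

(** In the interleaving argument w records how far both sequences exceed the
    trivial bound c * t from time k on. *)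
Definition above (w : R) (k b : nat) (y : nat -> R) :=
  forall t, (k <= t <= b)%N -> w + c * t%:R <= y t.

Lemma interleavedC a b y y' : interleaved a b y y' -> interleaved a b y' y.
Proof. by move=> yy' t s tab sab; case: (yy' s t sab tab); [right | left]. Qed.

(** Let i be the last time at which y is at most y' k, and j the last time at
    which y' is at most y i. After j both sequences exceed y i, which is at least
    w + c * j, by c * t, and this is the new excess for k' = j + 1. On the other
    hand y' k exceeds y i by c * k, so that y k + y' k <= k bounds the excess. *)
Lemma oscillation_step_le a b y y' k w :
  0 < c <= 1 -> interleaved a b y y' -> (a <= k)%N -> (0 < k)%N -> 0 <= w ->
  k%:R < c * b%:R -> above w k b y -> above w k b y' ->
  y k + y' k <= k%:R -> y k <= y' k ->
  exists k' : nat, let w' := w + c * (k'%:R - 1) in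
  [/\ (k < k' <= b)%N, c * (k'%:R - 1) <= k%:R, above w' k' b y, above w' k' b y' &
      2 * w + 2 * c * k%:R + c * (k'%:R - 1) <= k%:R].
Proof.
move=> /andP[c0 c1] yy' ak k0 w0 kb ay ay' yk yley'.
have cR t : (k <= t)%N -> 0 < c * t%:R.
  by move=> kt; rewrite mulr_gt0 // ltr0n; apply: leq_trans kt.
have leb t : c * t%:R <= k%:R -> (t < b)%N.
  by move=> tk; rewrite -(ltr_nat R) -(ltr_pM2l c0); apply: le_lt_trans tk kb.
have dich t s : (k <= t <= b)%N -> (k <= s <= b)%N ->
    y t + c * s%:R <= y' s \/ y' s + c * t%:R <= y t.
  by move=> /andP[kt tb] /andP[ks sb]; apply: yy'; rewrite ?tb ?sb andbT (leq_trans ak).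
have kleb : (k <= b)%N.
  by apply/ltnW/leb; rewrite ger_pMl // ltr0n.
have kk : (k <= k <= b)%N by rewrite leqnn.
have ayk := ay k kk; have ay'k := ay' k kk; have ck := cR k (leqnn k).
have [||i /andP[kib yi] imax] := @ex_maxnP [pred t | (k <= t <= b)%N && (y t <= y' k)] b.
- by exists k; rewrite /= kk.
- by move=> t /= /andP[/andP[]].
have /andP[ki ib] := kib; have ayi := ay i kib; have ci := cR i ki.
have y'k_ge : y i + c * k%:R <= y' k by case: (dich i k kib kk) => //; lra.
have [||j /andP[kjb /orP jP] jmax] :=
  @ex_maxnP [pred t | (k <= t <= b)%N && ((t == i) || (y' t <= y i))] b.
- by exists i; rewrite /= kib eqxx.
- by move=> t /= /andP[/andP[]].
have /andP[kj jb] := kjb; have cj := cR j kj.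
have ayj : w + c * j%:R <= y i.
  case: jP => [/eqP->//|y'j]; have ay'j := ay' j kjb.
  by case: (dich i j kib kjb); lra.
have ij : (i <= j)%N by apply: jmax; rewrite /= kib eqxx.
have {}jb : (j < b)%N by apply: leb; lra.
exists j.+1; rewrite -natr1 addrK; split.
- by rewrite ltnS kj.
- by lra.
- move=> t /andP[jt tb]; have kt : (k <= t)%N by apply: leq_trans kj (ltnW jt).
  have ct := cR t kt; have ktb : (k <= t <= b)%N by rewrite kt.
  have : ~~ (y t <= y' k).
    apply/negP => yt; have := imax t; rewrite /= ktb yt => /(_ isT) ti.
    by have := leq_ltn_trans (leq_trans ti ij) jt; rewrite ltnn.
  by rewrite -ltNge => yt; case: (dich t k ktb kk); lra.
- move=> t /andP[jt tb]; have kt : (k <= t)%N by apply: leq_trans kj (ltnW jt).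
  have ct := cR t kt; have ktb : (k <= t <= b)%N by rewrite kt.
  have : ~~ (y' t <= y i).
    apply/negP => yt; have := jmax t; rewrite /= ktb yt orbT => /(_ isT) tj.
    by have := leq_ltn_trans tj jt; rewrite ltnn.
  by rewrite -ltNge => yt; case: (dich i t kib ktb); lra.
- lra.
Qed.

Lemma oscillation_step a b y y' k w :
  0 < c <= 1 -> interleaved a b y y' -> (a <= k)%N -> (0 < k)%N -> 0 <= w ->
  k%:R < c * b%:R -> above w k b y -> above w k b y' ->
  y k + y' k <= k%:R ->
  exists k' : nat, let w' := w + c * (k'%:R - 1) in
  [/\ (k < k' <= b)%N, c * (k'%:R - 1) <= k%:R, above w' k' b y, above w' k' b y' &
      2 * w + 2 * c * k%:R + c * (k'%:R - 1) <= k%:R].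
Proof.
move=> c01 yy' ak k0 w0 kb ay ay' yk.
have [yley'|/ltW y'ley] := leP (y k) (y' k).
  exact: (@oscillation_step_le a b y y').
have [|k' [h1 h2 h3 h4 h5]] :=
  @oscillation_step_le a b y' y k w c01 (interleavedC yy') ak k0 w0 kb ay' ay _ y'ley.
  by rewrite addrC.
by exists k'.
Qed.

(** The ratio of w to k increases by a fixed amount in each step. In the limit
    of large k the increment is 2 u^2 - (1 - c) u + c (1 - 2 c) up to a positive
    factor, and the discriminant of this quadratic in u is 17 c^2 - 10 c + 1. The
    smaller root of the discriminant is 1 - (12 + sqrt 8) / 17, and this is where
    the constant of the theorem comes from. *)
Lemma oscillation_growth (u w k k' : R) :
  17 * c ^+ 2 - 10 * c + 1 < 0 ->
  let eta := - (17 * c ^+ 2 - 10 * c + 1) / 32 in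
  0 <= u -> u * k <= w -> 1 <= eta * k -> k + 1 <= k' ->
  2 * w + 2 * c * k + c * (k' - 1) <= k ->
  (u + eta) * k' <= w + c * (k' - 1).
Proof.
move=> hc eta u0 uk ek kk' h.
have c_gt : 1 / 10 < c by nra.
have c_lt : c < 1 / 2 by nra.
have eta_gt : 0 < eta by rewrite /eta; lra.
have eta_lt : eta < 1 / 20 by rewrite /eta; nra.
have disc : 4 * eta <= 2 * u ^+ 2 - u * (1 - c) + c * (1 - 2 * c).
  by have := sqr_ge0 (4 * u - (1 - c)); rewrite /eta; nra.
clearbody eta; have k_ge : 20 <= k by nra.
have [u_small|u_large] := leP (u + eta) c.
  suff : c <= (c - eta) * k by nra.
  by nra.
have u_lt : u < 1 / 2 by nra.
set e := u + eta - c; have e0 : 0 < e by rewrite /e; lra.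
suff : 0 <= c * (w - c - e * k') by rewrite pmulr_rge0 /e; lra.
have h1 : e * (c * k') <= e * (k * (1 - 2 * c) - 2 * w + c) by apply: ler_wpM2l; lra.
have h2 : u * k * (c + 2 * e) <= w * (c + 2 * e) by apply: ler_wpM2r => //; lra.
have h3 : 3 * eta <= u * (c + 2 * e) - e * (1 - 2 * c) by rewrite /e; nra.
have h4 : 3 <= k * (u * (c + 2 * e) - e * (1 - 2 * c)) by nra.
have h5 : c * (c + e) <= 1 by rewrite /e; nra.
clearbody e; lra.
Qed.

(** Iterating [oscillation_step], the ratio of w to k would exceed 1/2 after
    boundedly many steps, although 2 w is at most y k + y' k and thus at most k.
    As c exceeds 1/10, each step multiplies k by at most 11. *)
Lemma no_long_interleaving : 17 * c ^+ 2 - 10 * c + 1 < 0 ->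
  exists A k0 : nat, forall (a b : nat) (y y' : nat -> R),
  (k0 < a)%N -> (A * a <= b)%N -> interleaved a b y y' ->
  (forall t, (a <= t <= b)%N ->
     [/\ c * t%:R <= y t, c * t%:R <= y' t & y t + y' t <= t%:R]) -> False.
Proof.
move=> hc; pose eta := - (17 * c ^+ 2 - 10 * c + 1) / 32.
have eta0 : 0 < eta by rewrite /eta; lra.
have c_gt : 1 / 10 < c by nra.
have c_lt : c < 1 / 2 by nra.
pose k0 := Num.bound eta^-1; pose n0 := k0.
exists (11 ^ n0.+1)%N, k0 => a b y y' k0a Ab yy' hy.
have a0 : (0 < a)%N by apply: leq_ltn_trans k0a.
have ale n : (a <= 11 ^ n * a)%N by rewrite leq_pmull // expn_gt0.
have stage n : (n <= n0)%N -> exists (k : nat) (w : R),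
    [/\ (a <= k <= 11 ^ n * a)%N, n%:R * eta * k%:R <= w, 0 <= w,
        above w k b y & above w k b y'].
  elim: n => [_|n IHn ltn].
    exists a, 0; rewrite mul1n leqnn !mul0r; split => // t tab; rewrite add0r;
      by case: (hy t tab).
  have [k [w [/andP[ak kA] wn w0 ay ay']]] := IHn (ltnW ltn).
  have kb : (11 * k <= b)%N.
    apply: leq_trans Ab; apply: (@leq_trans (11 ^ n.+1 * a)).
      by rewrite expnS -mulnA leq_mul2l.
    by rewrite leq_mul2r leq_pexp2l ?orbT // ltnW.
  have k_pos : (0 < k)%N by apply: leq_trans ak.
  have kR : (1 : R) <= k%:R by rewrite ler1n.
  have kbR : 11 * k%:R <= b%:R :> R by rewrite -natrM ler_nat.
  have kcb : k%:R < c * b%:R by nra.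
  have akb : (a <= k <= b)%N by rewrite ak; apply: leq_trans kb; rewrite leq_pmull.
  have c01 : 0 < c <= 1 by apply/andP; split; lra.
  have yk : y k + y' k <= k%:R by case: (hy k akb).
  have [k' [/andP[kk' k'b] k'k ay1 ay'1 hk']] :=
    oscillation_step c01 yy' ak k_pos w0 kcb ay ay' yk.
  exists k', (w + c * (k'%:R - 1)).
  have k'ge : k%:R + 1 <= k'%:R :> R by rewrite natr1 ler_nat.
  split => //.
  - rewrite (leq_trans ak (ltnW kk')) /= expnS -mulnA.
    apply: (@leq_trans (11 * k)); last by rewrite leq_mul2l.
    by rewrite -(ler_nat R) natrM; nra.
  - rewrite -natr1 mulrDl mul1r; apply: (oscillation_growth hc _ wn _ k'ge hk').
    + by rewrite mulr_ge0 // ltW.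
    + rewrite -/eta mulrC -ler_pdivrMr // div1r; apply/ltW.
      apply: lt_le_trans (archi_boundP _) _; first by rewrite invr_ge0 ltW.
      by rewrite ler_nat -/k0 (leq_trans (ltnW k0a)).
  - by rewrite addr_ge0 // mulr_ge0 //; lra.
have [k [w [/andP[ak kA] wn w0 ay ay']]] := stage n0 (leqnn _).
have akb : (k <= k <= b)%N.
  rewrite leqnn; apply: leq_trans Ab; apply: leq_trans kA _.
  by rewrite leq_mul2r leq_pexp2l ?orbT.
have [_ _ yk] : [/\ c * k%:R <= y k, c * k%:R <= y' k & y k + y' k <= k%:R].
  by apply: hy; rewrite ak; case/andP: akb.
have := ay k akb; have := ay' k akb => h1 h2.
have kR : (1 : R) <= k%:R by rewrite ler1n; apply: leq_trans ak.
have : 1 < n0%:R * eta.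
  rewrite -ltr_pdivrMr // div1r; apply: archi_boundP.
  by rewrite invr_ge0 ltW.
by nra.
Qed.
End Oscillation.

(** * Dense forests *)

(** Room for the error terms of the approximate covers. *)
Lemma slack (R : realType) (c : R) : 17 * c ^+ 2 - 10 * c + 1 < 0 ->
  exists2 c1 : R, c1 < c & 17 * c1 ^+ 2 - 10 * c1 + 1 < 0.
Proof.
move=> hc; exists (c + (17 * c ^+ 2 - 10 * c + 1) / 20); first by lra.
set q := _ + 1 in hc *; have q_ge : - 1 / 2 <= q.
  by have := sqr_ge0 (17 * c - 5); rewrite /q; lra.
have -> : 17 * (c + q / 20) ^+ 2 - 10 * (c + q / 20) + 1 =
  q + 34 / 20 * c * q + 17 / 400 * q ^+ 2 - q / 2 by rewrite /q; field.
have c0 : 0 < c by rewrite /q in hc; nra.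
clearbody q; nra.
Qed.

(** If no forest in either colour were this dense, [forest_or_cover] would
    give, at each time t and for each colour, a set Y of vertices of the other
    colour in [1, t] whose neighbourhood N in that colour, up to boundedly many
    edges at each vertex, is smaller by c1 * t. Compare the red pair at t with
    the blue pair at s. Between the red vertices of the second Y outside the
    first N and the blue vertices of the first Y outside the second N both red
    and blue edges are sparse, so one of these two sets is bounded by
    [one_side_small]. Hence the cardinalities of the sets Y are interleaved,
    which [no_long_interleaving] excludes. *)
Lemma dense_forest (R : realType) (col : rel nat) (chi : nat -> bool) (c : R) :
  symmetric col -> 17 * c ^+ 2 - 10 * c + 1 < 0 ->
  forall (F0 : seq nat) (t0 : nat), exists (k : bool) (t : nat) (ps : seq (seq nat)),
  [/\ (t0 <= t)%N, (0 < t)%N, colour_forest col chi k ps,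
      all [pred v | (0 < v)%N && (v \notin F0)] (flatten ps) &
      (1 - c) * t%:R <= (count (fun v => v <= t)%N (flatten ps))%:R].
Proof.
move=> col_sym hc F0 t0; apply: contrapT => none.
have [c1 c1c hc1] := slack hc.
have [A [k0 noint]] := no_long_interleaving hc1.
pose del := c - c1; have del0 : 0 < del by rewrite /del; lra.
pose q := (Num.bound (2 / del)).+1.
have qdel : q%:R^-1 <= del / 2.
  have : 2 / del < q%:R.
    apply: lt_le_trans (archi_boundP _) _; first by rewrite divr_ge0 // ltW.
    by rewrite ler_nat.
  rewrite ltr_pdivrMr // => h; rewrite ler_pdivlMr // mulrC ler_pdivrMr ?ltr0n // mulrC.
  exact: ltW.
have [K HK] := @forest_or_cover q isT.
pose f0 := size F0.
pose m := Num.bound (2 * (f0 + 2 * K)%:R / del).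
pose a := (t0 + k0 + m).+1; pose b := ((A + 1) * a)%N.
have [t0a k0a ma] : [/\ (t0 <= a)%N, (k0 < a)%N & (m <= a)%N].
  by rewrite /a; move: (m) => m'; split; lia.
pose S (k : bool) : {set 'I_b.+1} :=
  [set v : 'I_b.+1 | [&& (0 < v)%N, val v \notin F0 & chi v == k]].
pose X k t : {set 'I_b.+1} := [set v in S (~~ k) | (v <= t)%N].
pose e k : rel 'I_b.+1 := fun u v => col u v == k.
have covers (kt : bool * nat) : exists YN : {set 'I_b.+1} * {set 'I_b.+1},
    (a <= kt.2 <= b)%N ->
    [/\ YN.1 \subset X kt.1 kt.2,
      {in YN.1, forall x, (#|[set z in S kt.1 | e kt.1 x z] :\: YN.2| <= K)%N} &
      #|YN.2|%:R + (2 * K)%:R + c1 * kt.2%:R <= #|YN.1|%:R :> R].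
  case: kt => k t /=.
  case: (boolP (a <= t <= b)%N) => [/andP[ta tb]|_]; last by exists (set0, set0).
  have [||G [Y [N [ps [[GX ups psE psP] [YX YK card]]]]]] :=
      HK 'I_b.+1 ord0 (X k t) (S k) (e k).
  - by move=> u v; rewrite /e col_sym.
  - rewrite disjoint_sym disjoints_subset; apply/subsetP => v; rewrite !inE.
    by move=> /and3P[_ _ /eqP->]; case: k; rewrite !andbF.
  exists (Y, N) => _; split => //=.
  (* The forest contains everything in [1, t] outside F0 and X \ G, and it is
     not dense at t. *)
  have missed : c * t%:R <= (f0 + #|X k t :\: G|)%:R.
    rewrite leNgt; apply/negP => lt; apply: none.
    exists k, t, (map (map val) ps).
    rewrite -map_flatten; split.
    + exact: leq_trans t0a ta.
    + by apply: leq_trans ta.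
    + rewrite /colour_forest -map_flatten map_inj_uniq ?ups /=; last exact: val_inj.
      apply/allP => _ /mapP[p pps ->]; have := allP psP p pps.
      case: p {pps} => //= x p /and3P[]; rewrite !inE last_map => /and3P[_ _ ->] /and3P[_ _ ->] pth.
      by rewrite path_map.
    + apply/allP => _ /mapP[v vps ->] /=; move: vps; rewrite psE inE.
      by case/orP => [|/(subsetP GX)]; rewrite !inE;
        [case/and3P=> -> -> | case/andP=> /and3P[-> ->]].
    + rewrite count_map.
      have : (t <= f0 + #|X k t :\: G| + count (preim val (fun v => v <= t)%N) (flatten ps))%N.
        rewrite -{1}(count_initial tb).
        pose F1 : {set 'I_b.+1} := [set v : 'I_b.+1 | val v \in F0].
        pose C := [set v in flatten ps | (v <= t)%N].
        have cF1 : (#|F1| <= f0)%N.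
          rewrite cardE -(size_map val); apply: uniq_leq_size.
            by rewrite map_inj_uniq ?enum_uniq //; apply: val_inj.
          by move=> _ /mapP[v + ->]; rewrite mem_enum inE.
        have cC : (#|C| <= count (preim val (fun v => v <= t)%N) (flatten ps))%N.
          rewrite -size_filter; apply: leq_trans (card_size _).
          apply/subset_leq_card/subsetP => v.
          by rewrite !inE mem_filter andbC.
        apply: (@leq_trans #|F1 :|: (X k t :\: G) :|: C|).
          apply/subset_leq_card/subsetP => v; rewrite !inE psE !inE => /andP[v0 vt].
          rewrite v0 vt; case: (val v \in F0) => //=; case: (v \in G); rewrite ?orbT //=.
          by case: (chi v); case: (k).
        apply: leq_trans (leq_card_setU _ _) _; apply: leq_add => //.
        by apply: leq_trans (leq_card_setU _ _) _; rewrite leq_add2r.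
      rewrite -(ler_nat R) natrD; lra.
  have cX : (#|X k t| <= t)%N.
    rewrite -{2}(count_initial tb); apply/subset_leq_card/subsetP => v.
    by rewrite !inE => /andP[/and3P[-> _ _] ->].
  have q0 : 0 < q%:R :> R by rewrite ltr0n.
  have hXq : q%:R * (#|N|%:R + #|X k t :\: G|%:R) <= q%:R * #|Y|%:R + t%:R :> R.
    rewrite -natrD -!natrM -natrD ler_nat; apply: leq_trans card _.
    by rewrite leq_add2l.
  have hN : #|N|%:R + #|X k t :\: G|%:R <= #|Y|%:R + del / 2 * t%:R :> R.
    have h : t%:R <= q%:R * (del / 2 * t%:R) :> R.
      rewrite mulrA -[X in X <= _]mul1r ler_wpM2r // mulrC -ler_pdivrMr //.
      by rewrite mul1r.
    by rewrite -(ler_pM2l q0); apply: le_trans hXq _; rewrite [X in _ <= X]mulrDr lerD2l.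
  have hm : (f0 + 2 * K)%:R <= del / 2 * t%:R :> R.
    have : 2 * (f0 + 2 * K)%:R / del < t%:R.
      apply: lt_le_trans (archi_boundP _) _; first by rewrite !mulr_ge0 // invr_ge0 ltW.
      by rewrite ler_nat (leq_trans ma).
    by rewrite ltr_pdivrMr //; lra.
  move: missed hm; rewrite !natrD /del in hN *; lra.
have [YN HYN] := choice covers.
pose y k t : R := #|(YN (k, t)).1|%:R.
apply: (noint a b (y true) (y false)).
- by [].
- by rewrite /b leq_mul2r leq_addr orbT.
- move=> t s tab sab.
  have [Yt Kt ct] := HYN (true, t) tab; have [Ys Ks cs] := HYN (false, s) sab.
  rewrite /= in Yt Kt ct Ys Ks cs; rewrite /y.
  move: (YN (true, t)).1 (YN (true, t)).2 (YN (false, s)).1 (YN (false, s)).2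
    Yt Kt ct Ys Ks cs => Yt Nt Ys Ns Yt1 Kt ct Ys1 Ks cs.
  have small : (#|Ys :\: Nt| <= 2 * K)%N \/ (#|Yt :\: Ns| <= 2 * K)%N.
    apply: (@one_side_small _ _ _ (fun u v : 'I_b.+1 => col u v)).
    + move=> x /setDP[xY _]; apply: leq_trans (Kt x xY).
      apply/subset_leq_card/subsetP => z; rewrite !inE => /andP[/andP[-> zY]].
      by move/subsetP: Ys1 => /(_ z zY); rewrite !inE /e => /andP[-> _] ->.
    + move=> z /setDP[zY _]; apply: leq_trans (Ks z zY).
      apply/subset_leq_card/subsetP => x; rewrite !inE => /andP[/andP[-> xY]].
      by move/subsetP: Yt1 => /(_ x xY); rewrite !inE /e col_sym => /andP[-> _] /negPf->.
  have sz (U V : {set 'I_b.+1}) : (#|U :\: V| <= 2 * K)%N -> #|U|%:R <= #|V|%:R + (2 * K)%:R :> R.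
    rewrite -natrD ler_nat => h; rewrite -(cardsID V U) leq_add //.
    by rewrite subset_leq_card // subsetIr.
  by case: small => /sz h; [right | left]; lra.
- move=> t tab; have [Yt _ ct] := HYN (true, t) tab; have [Ys _ cs] := HYN (false, t) tab.
  rewrite /= in Yt ct Ys cs; rewrite /y; split.
  + by apply: le_trans ct; rewrite lerDr -natrD.
  + by apply: le_trans cs; rewrite lerDr -natrD.
  + rewrite -natrD ler_nat; have /andP[_ tb] := tab.
    rewrite -[X in (_ <= X)%N](count_initial tb) -cardsUI.
    have -> : (YN (true, t)).1 :&: (YN (false, t)).1 = set0.
      apply/setP => v; rewrite !inE; apply/negP => /andP[/(subsetP Yt) + /(subsetP Ys)].
      by rewrite !inE => /andP[/and3P[_ _ /eqP->] _] /andP[/and3P[]].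
    rewrite cards0 addn0; apply/subset_leq_card/subsetP => v.
    rewrite !inE => /orP[/(subsetP Yt)|/(subsetP Ys)]; rewrite !inE;
      by case/andP => /and3P[-> _ _] ->.
Qed.

(** * From dense forests to an infinite path *)

Section Gluing.
Variables (R : realType) (col : rel nat) (chi : nat -> bool) (alpha : R) (k : bool).

(** The parameter n bounds t from below and also sets the tolerance; with n + 2
    in the denominator the density stays positive as long as alpha > 1/2. *)
Definition dense_at (n : nat) (s : seq nat) := exists t : nat,
  [/\ (n <= t)%N, (0 < t)%N & (alpha - n.+2%:R^-1) * t%:R <= (count (fun v => v <= t)%N s)%:R].

(** The path is the limit of finite paths, the n-th of which is extended by a
    forest avoiding it that is dense at some time beyond n. *)
Lemma infinite_monochromatic_path :
  symmetric col -> 1 / 2 < alpha ->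
  (forall u v n, chi u = chi v ->
    exists2 w, (n <= w)%N & (col u w == chi u) && (col v w == chi u)) ->
  (forall n (F0 : seq nat), exists2 ps : seq (seq nat), colour_forest col chi k ps &
     all [pred v | (0 < v)%N && (v \notin F0)] (flatten ps) /\ dense_at n (flatten ps)) ->
  exists v : nat -> nat,
  [/\ injective v, forall i, (0 < v i)%N, forall i, col (v i) (v i.+1) = k &
      forall n, exists2 s, uniq s /\ dense_at n s & forall x, x \in s -> exists i, x = v i].
Proof.
move=> col_sym alpha2 nbr dense.
have dense_nonempty n s : dense_at n s -> s != [::].
  move=> [t [_ t0 h]]; apply/eqP => s0; move: h; rewrite s0 /=.
  have inv2 : n.+2%:R^-1 <= 1 / 2 :> R by rewrite div1r lef_pV2 ?posrE ?ltr0n // ler_nat.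
  by rewrite leNgt mulr_gt0 // ?ltr0n // subr_gt0; apply: le_lt_trans alpha2.
have [x0 x0P] : exists x0, monochromatic_path col chi k x0 [::].
  have [ps /andP[_ allps] [pos /dense_nonempty]] := dense 0%N [::].
  case: ps allps pos => // -[//|x c] ps /= /andP[/and3P[xk _ _] _] /andP[/andP[x0 _] _] _.
  by exists x; rewrite /monochromatic_path /= xk x0.
pose good p := monochromatic_path col chi k x0 p.
have step (np : nat * seq nat) : exists q, good np.2 ->
    [/\ good (np.2 ++ q), q != [::] & dense_at np.1 (x0 :: np.2 ++ q)].
  case: np => n p /=; case: (boolP (good p)) => [gp|_]; last by exists [::].
  have [ps fps [avoid dps]] := dense n (x0 :: p).
  have [q gq qs] := extend_by_forest col_sym nbr gp fps avoid.
  exists q => _; split => //.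
    apply: contraNneq (dense_nonempty _ _ dps) => q0; move: qs; rewrite q0.
    by case: (flatten ps) => // v s /(_ v (mem_head _ _)).
  have [t [nt t0 h]] := dps; exists t; split => //; apply: le_trans h _.
  rewrite ler_nat -!size_filter; apply: uniq_leq_size.
    by rewrite filter_uniq //; case/andP: fps.
  move=> v; rewrite !mem_filter => /andP[-> /qs vq] /=.
  by rewrite inE mem_cat vq !orbT.
have [g gP] := choice step.
pose P := fix P n := if n is n'.+1 then P n' ++ g (n', P n') else [::].
have goodP n : good (P n).
  by elim: n => // n IH; case: (gP (n, P n) IH).
have PS n : P n.+1 = P n ++ g (n, P n) by [].
have sizeP n : (n <= size (P n))%N.
  elim: n => // n IH; rewrite PS size_cat; case: (gP (n, P n) (goodP n)) => _ + _.
  by rewrite -size_eq0 -lt0n /=; lia.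
have prefix_nth m n i : (m <= n)%N -> (i <= size (P m))%N ->
    nth 0%N (x0 :: P n) i = nth 0%N (x0 :: P m) i.
  move=> /subnKC <-; elim: (n - m)%N => [|d IH] im; first by rewrite addn0.
  rewrite addnS PS -cat_cons nth_cat /= ltnS (leq_trans im) ?IH //.
  elim: d {IH} => [|d IHd]; first by rewrite addn0.
  by rewrite addnS PS size_cat (leq_trans IHd) // leq_addr.
pose v i := nth 0%N (x0 :: P i) i.
have vE n i : (i <= size (P n))%N -> v i = nth 0%N (x0 :: P n) i.
  move=> isz; case: (leqP i n) => [le|/ltnW le].
    by rewrite /v -(prefix_nth i n) // sizeP.
  by rewrite /v (prefix_nth n i).
exists v; split.
- move=> i j; have iP := sizeP (maxn i j).
  rewrite (vE (maxn i j) i) ?(vE (maxn i j) j) ?(leq_trans _ iP) ?leq_maxl ?leq_maxr // => /eqP.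
  have /and4P[u _ _ _] := goodP (maxn i j).
  rewrite nth_uniq //= ?ltnS ?(leq_trans _ iP) ?leq_maxl ?leq_maxr //.
  by move/eqP.
- move=> i; have /and4P[_ _ _ /allP h] := goodP i; apply: h.
  by rewrite mem_nth //= ltnS.
- move=> i; have /and4P[_ /(pathP 0%N) h _ _] := goodP i.+1.
  rewrite (vE i.+1 i) ?(vE i.+1 i.+1) ?(leq_trans _ (sizeP i.+1)) //=.
  by apply/eqP/h; apply: leq_trans (sizeP i.+1).
- move=> n; exists (x0 :: P n.+1).
    by split; [have /andP[] := goodP n.+1 | case: (gP (n, P n) (goodP n))].
  move=> x /(nthP 0%N)[i isz <-]; exists i; rewrite (vE n.+1) //.
Qed.
End Gluing.

Lemma le_limn_sup (R : realType) (u : nat -> R) (a : R) :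
  (forall t, 0 <= u t <= 1) ->
  (forall n, exists2 t, (n <= t)%N & a - n.+2%:R^-1 <= u t) ->
  a <= limn_sup u.
Proof.
move=> u01 freq.
have ub : bounded_fun (u : nat -> R^o).
  exists 1; split => // M M1 t _ /=; have /andP[u0 u1] := u01 t.
  by rewrite ger0_norm // (le_trans u1) // ltW.
rewrite limn_supE //; apply: lb_le_inf; first by exists (sups u 0%N), 0%N.
move=> _ [n _ <-]; apply/ler_addgt0Pr => e e0.
have [t nt ht] := freq (maxn n (Num.bound e^-1)).
apply: (@le_trans _ _ (u t + e)).
  suff : (maxn n (Num.bound e^-1)).+2%:R^-1 <= e.
    by move=> h; rewrite -lerBlDr (le_trans _ ht) // lerD2l lerN2.
  rewrite -[X in _ <= X]invrK lef_pV2 ?posrE ?invr_gt0 ?ltr0n //.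
  apply/ltW/(lt_le_trans (archi_boundP _)); first by rewrite invr_ge0 ltW.
  by rewrite ler_nat; apply/leqW/leqW/leq_maxr.
rewrite lerD2r; apply: ub_le_sup.
  by exists 1 => _ [m _ <-]; case/andP: (u01 m).
by exists t => //=; apply: leq_trans nt; apply: leq_maxl.
Qed.

(** If each colour failed for some tolerance and some finite set, then
    [dense_forest] would fail for the smaller tolerance and the union of the two
    sets. *)
Lemma dense_colour (R : realType) (col : rel nat) (chi : nat -> bool) :
  symmetric col -> exists k, forall n (F0 : seq nat),
  exists2 ps : seq (seq nat), colour_forest col chi k ps &
     all [pred v | (0 < v)%N && (v \notin F0)] (flatten ps) /\
     dense_at ((12 + Num.sqrt 8) / 17 : R) n (flatten ps).
Proof.
move=> col_sym; pose s8 : R := Num.sqrt 8.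
have s8E : s8 ^+ 2 = 8 by rewrite sqr_sqrtr.
have s80 : 0 <= s8 by rewrite sqrtr_ge0.
apply: contrapT => /forallNP none.
have fails k : exists nF : nat * seq nat, forall ps, colour_forest col chi k ps ->
    all [pred v | (0 < v)%N && (v \notin nF.2)] (flatten ps) ->
    ~ dense_at ((12 + s8) / 17) nF.1 (flatten ps).
  have /existsNP[n /existsNP[F0 hF]] := none k.
  by exists (n, F0) => ps fps av dps; apply: hF; exists ps.
have [f hf] := choice fails.
(* The summand 10 keeps c below the larger root (5 + sqrt 8) / 17. *)
pose n := (10 + (f true).1 + (f false).1)%N.
have nR : 12 <= n.+2%:R :> R by rewrite ler_nat /n; lia.
have inv0 : 0 < n.+2%:R^-1 :> R by rewrite invr_gt0; lra.
have inv12 : n.+2%:R^-1 <= 1 / 12 :> R by rewrite div1r lef_pV2 ?posrE; lra.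
pose c := (5 - s8) / 17 + n.+2%:R^-1.
have hc : 17 * c ^+ 2 - 10 * c + 1 < 0.
  rewrite /c; move: (n.+2%:R^-1) inv0 inv12 => x x0 x12.
  have -> : 17 * ((5 - s8) / 17 + x) ^+ 2 - 10 * ((5 - s8) / 17 + x) + 1 =
    (s8 ^+ 2 - 8) / 17 + x * (17 * x - 2 * s8) by field.
  have s8_gt : 2 < s8 by nra.
  rewrite s8E; nra.
have [k [t [ps [nt t0 fps avoid h]]]] :=
  dense_forest chi col_sym hc ((f true).2 ++ (f false).2) n.
have nk : ((f k).1 <= n)%N by rewrite /n; case: (k); lia.
apply: (hf k ps fps).
  apply: sub_all avoid => v /= /andP[-> ]; rewrite mem_cat negb_or.
  by case/andP; case: (k).
exists t; split => //; first exact: leq_trans nt.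
apply: le_trans h; apply: ler_wpM2r => //.
suff : n.+2%:R^-1 <= (f k).1.+2%:R^-1 :> R.
  by rewrite /c; move: (n.+2%:R^-1) ((f k).1.+2%:R^-1) => x y; lra.
by rewrite lef_pV2 ?posrE ?ltr0n // ler_nat !ltnS.
Qed.

Lemma upper_density_ge (R : realType) (G : graph nat) (a : R) :
  (forall n, exists2 s, uniq s /\ dense_at a n s &
     forall x, x \in s -> (0 < x)%N /\ vertices G x) ->
  a <= upper_density R G.
Proof.
move=> dense; set A := fun t => (vertices G `&` [set n | (1 <= n <= t)%N])%classic.
have finA t : finite_set (A t).
  apply: (@sub_finite_set _ _ `I_t.+1); last exact: finite_II.
  by move=> x [_ /= /andP[_]].
apply: le_limn_sup => [t|n].
  have [->|t0] := posnP t; first by rewrite invr0 mulr0 lexx ler01.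
  rewrite divr_ge0 //= ler_pdivrMr ?ltr0n // mul1r ler_nat.
  rewrite -[X in (_ <= X)%N](size_iota 1 t); apply: uniq_leq_size => [|x].
    exact: fset_uniq.
  rewrite (in_fset_set (finA t)) => /set_mem[_ /=]; rewrite mem_iota add1n ltnS; exact.
have [s [us [t [nt t0 h]]] sG] := dense n.
exists t => //; rewrite ler_pdivlMr ?ltr0n //; apply: le_trans h _.
rewrite ler_nat -size_filter; apply: uniq_leq_size; first by rewrite filter_uniq.
move=> x; rewrite mem_filter => /andP[xt /sG[x0 xG]].
by rewrite (in_fset_set (finA t)); apply/mem_set; split => //=; rewrite x0.
Qed.

Definition colour_of (k : bool) := if k then Red else Blue.

(** Equality of the endpoints as a set avoids choosing a proof that u and v
    form an edge; on pairs that are not edges the value is irrelevant. *)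
Definition red_edge (c : edges KN -> colour) : rel nat := fun u v =>
  `[< forall e : edges KN, val e = [set u; v]%classic -> c e = Red >].

Lemma red_edge_sym c : symmetric (red_edge c).
Proof. by move=> u v; rewrite /red_edge classical_sets.setUC. Qed.

Lemma red_edgeP c u v (e : edges KN) :
  val e = [set u; v]%classic -> c e = colour_of (red_edge c u v).
Proof.
move=> eE; rewrite /red_edge; case: asboolP => [->//|/existsNP[e' /not_implyP[e'E]]] /=.
have -> : e' = e by apply: val_inj; rewrite eE.
by case: (c e).
Qed.

Definition path_graph (T : Type) (v : nat -> T) (v_inj : injective v) : graph T.
Proof.
refine (@Graph T (range v) [set [set v i; v i.+1] | i in [set: nat]]%classic _).
move=> e [i _ <-]; exists (v i), (v i.+1); split => //; try by eexists.
by move/v_inj/eqP; rewrite eqn_leq ltnn andbF.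
Defined.

Theorem theorem1p2 (R : realType) (c : edges KN -> colour) :
  exists P : graph nat,
    [/\ subgraph P KN, infinite_path P, monochromatic c P &
        (12 + Num.sqrt 8) / 17 <= upper_density R P].
Proof.
have [chi nbr] := common_neighbours (red_edge c).
have [k dense] := dense_colour R chi (red_edge_sym c).
have alpha2 : 1 / 2 < (12 + Num.sqrt 8) / 17 :> R by have := sqrtr_ge0 (8 : R); lra.
have [v [v_inj v_pos v_col v_dense]] :=
  infinite_monochromatic_path (red_edge_sym c) alpha2 nbr dense.
exists (path_graph v_inj); split.
- split => [_ [i _ <-]|_ [i _ <-]] /=; first exact: v_pos.
  exists (v i), (v i.+1); split => //; try exact: v_pos.
  by move/v_inj/eqP; rewrite eqn_leq ltnn andbF.
- by exists v.
- exists (colour_of k) => e [i _ eE].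
  by rewrite (red_edgeP c (esym eE)) v_col.
- apply: upper_density_ge => n; have [s sP sv] := v_dense n; exists s => // x /sv[i ->].
  by split; [exact: v_pos | exists i].
Qed.
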